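(* Every RA-counterexample is also a DR-counterexample. Furthermore, if every one-ended digraph that contains infinitely many rays and infinitely many anti-rays that are all pairwise disjoint also contains infinitely many pairwise disjoint double rays, then there exists an RA-counterexample if and only if there exists a DR-counterexample.
   Context: Digraphs may be infinite; containment is as subdigraphs; disjoint means vertex-disjoint. A dipath is a (finite) directed path. For vertex sets $A,B$, an $A$--$B$ dipath is a dipath that starts at a vertex of $A$, ends at a vertex of $B$ and is internally disjoint from $A\cup B$; for subdigraphs $Q,R$, a $Q$--$R$ dipath is a $V(Q)$--$V(R)$ dipath. A ray is a digraph with precisely one vertex $v$ of out-degree $1$ and in-degree $0$, with a dipath from $v$ to each of its vertices, and all of whose vertices other than $v$ have out-degree $1$ and in-degree $1$. An anti-ray is obtained from a ray by reversing all edges. A double ray is an infinite digraph all of whose vertices have in- and out-degree $1$ and such that for all vertices $v,w$ there exists a $v$--$w$ or a $w$--$v$ dipath. For rays or anti-rays $Q,R$ in a digraph $D$ write $Q\le R$ if there are infinitely many pairwise disjoint $Q$--$R$ dipaths in $D$, and $Q\sim R$ if $Q\le R$ and $R\le Q$. Then $\sim$ is an equivalence relation on the set of all rays and anti-rays in $D$, and its equivalence classes are the ends of $D$. A digraph is one-ended if it has exactly one end. An RA-counterexample is a counterexample to the ubiquity of the disjoint union of a ray and an anti-ray, that is, a digraph $D$ that contains, for every $n\in\mathbb N$, a set of $n$ rays and $n$ anti-rays that are all pairwise disjoint, but does not contain a set of infinitely many rays and infinitely many anti-rays that are all pairwise disjoint. A DR-counterexample is a counterexample to the ubiquity of the double ray,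 that is, a digraph $D$ that contains, for every $n\in\mathbb N$, a set of $n$ pairwise disjoint double rays, but does not contain infinitely many pairwise disjoint double rays. *)

(* Defs.v *)
From mathcomp Require Import all_boot.
From mathcomp Require Import boolp classical_sets functions cardinality.

Set Implicit Arguments.
Unset Strict Implicit.
Unset Printing Implicit Defensive.

Local Open Scope classical_set_scope.
Local Open Scope card_scope.

(* Vertices are drawn from an ambient type V, so that a digraph, its
   subdigraphs and the rays and dipaths contained in it all have the same type
   and containment is an inclusion. *)
Record digraph (V : Type) : Type := Digraph {
  vset : set V;
  arc : V -> V -> Prop;
  arc_vset : forall u v, arc u v -> vset u /\ vset v
}.

Section Digraphs.
Variable V : Type.
Implicit Types (D H P Q R : digraph V) (S : set (digraph V)) (A B : set V).

Definition subdigraph H D : Prop :=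
  vset H `<=` vset D /\ (forall u v, arc H u v -> arc D u v).

Definition reverse D : digraph V :=
  @Digraph V (vset D) (fun u v => arc D v u)
    (fun u v uv => conj (proj2 (arc_vset uv)) (proj1 (arc_vset uv))).

Definition outdeg1 D (v : V) : Prop := exists! w, arc D v w.
Definition indeg1 D (v : V) : Prop := exists! u, arc D u v.
Definition indeg0 D (v : V) : Prop := forall u, ~ arc D u v.

(* A dipath of length 0 is a single vertex. *)
Definition dipath (a b : V) P : Prop :=
  exists (n : nat) (f : nat -> V),
    [/\ set_inj `I_n.+1 f, f 0 = a, f n = b, vset P = f @` `I_n.+1
      & forall u v, arc P u v <-> exists2 i, i < n & u = f i /\ v = f i.+1].

Definition has_dipath D (a b : V) : Prop :=
  exists2 P, subdigraph P D & dipath a b P.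

Definition set_dipath A B P : Prop :=
  exists a b, [/\ A a, B b, dipath a b P
    & forall x, vset P x -> x <> a -> x <> b -> ~ (A `|` B) x].

(* The last clause makes v the only vertex of in-degree 0. *)
Definition ray R : Prop :=
  exists v, [/\ vset R v, outdeg1 R v, indeg0 R v,
    forall w, vset R w -> has_dipath R v w
    & forall w, vset R w -> w <> v -> outdeg1 R w /\ indeg1 R w].

Definition antiray R : Prop := ray (reverse R).

Definition double_ray R : Prop :=
  [/\ infinite_set (vset R),
    forall v, vset R v -> outdeg1 R v /\ indeg1 R v
    & forall v w, vset R v -> vset R w -> has_dipath R v w \/ has_dipath R w v].

Definition pairwise_disjoint S : Prop := trivIset S (@vset V).

Definition ray_or_antiray_in D R : Prop :=
  subdigraph R D /\ (ray R \/ antiray R).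

Definition ray_le D Q R : Prop :=
  exists S, [/\ infinite_set S, pairwise_disjoint S
    & forall P, S P -> subdigraph P D /\ set_dipath (vset Q) (vset R) P].

Definition ray_equiv D Q R : Prop := ray_le D Q R /\ ray_le D R Q.

Definition is_end D (e : set (digraph V)) : Prop :=
  exists2 R, ray_or_antiray_in D R
    & e = [set Q | ray_or_antiray_in D Q /\ ray_equiv D Q R].

Definition one_ended D : Prop := exists! e, is_end D e.

Definition disjoint_rays_antirays D (RS AS : set (digraph V)) : Prop :=
  [/\ forall R, RS R -> subdigraph R D /\ ray R,
    forall R, AS R -> subdigraph R D /\ antiray R
    & pairwise_disjoint (RS `|` AS)].

Definition has_n_rays_antirays D (n : nat) : Prop :=
  exists RS AS, [/\ RS #= `I_n, AS #= `I_n & disjoint_rays_antirays D RS AS].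

Definition has_infinite_rays_antirays D : Prop :=
  exists RS AS,
    [/\ infinite_set RS, infinite_set AS & disjoint_rays_antirays D RS AS].

Definition disjoint_double_rays D S : Prop :=
  (forall R, S R -> subdigraph R D /\ double_ray R) /\ pairwise_disjoint S.

Definition has_n_double_rays D (n : nat) : Prop :=
  exists2 S, S #= `I_n & disjoint_double_rays D S.

Definition has_infinite_double_rays D : Prop :=
  exists2 S, infinite_set S & disjoint_double_rays D S.

Definition RA_counterexample D : Prop :=
  (forall n, has_n_rays_antirays D n) /\ ~ has_infinite_rays_antirays D.

Definition DR_counterexample D : Prop :=
  (forall n, has_n_double_rays D n) /\ ~ has_infinite_double_rays D.

End Digraphs.

(* Main.v *)
From mathcomp Require Import all_boot all_order all_algebra.
From mathcomp Require Import zify.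
From mathcomp Require Import boolp classical_sets functions cardinality.
Require Import Defs.

Set Implicit Arguments.
Unset Strict Implicit.
Unset Printing Implicit Defensive.
Import Order.TTheory GRing.Theory Num.Theory.
Local Open Scope classical_set_scope.
Local Open Scope card_scope.

(* Given n disjoint rays and N > n further disjoint rays, let each of the first
   ones follow its course until it meets one of the others and then try to switch
   to it, the ray met preferring whoever meets it later. The stable outcome
   consists of n disjoint rays with the old starting segments, and all but n of
   the N rays are untouched. Iterating this turns arbitrarily large families into
   an infinite one as long as rays and anti-rays do not interfere, e.g. when the
   rays lie in a set U and the anti-rays outside U.

   An RA-counterexample without n disjoint double rays has an anti-ray and a ray
   which a finite set separates, and one of the two sides still contains
   arbitrarily many rays and anti-rays. Repeating this on that side produces
   infinitely many rays outside the nested sides (up to reversal); each anti-ray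
   meets the discarded parts finitely, so rerouting the anti-rays on the remaining
   sides yields infinitely many rays and anti-rays, a contradiction.

   In a DR-counterexample, pass to an induced subdigraph in which no separation
   has double rays on both sides. Call a set negligible if it meets only boundedly
   many disjoint double rays. One side of each finite separation is negligible,
   and boundedly many disjoint double rays have a negligible half. A locally
   finite union of finite families of the other double rays is no
   RA-counterexample if none exists, hence contains infinitely many rays and anti-rays; any two
   infinite sets of vertices of this union are linked outside every finite set.
   Adding suitable linking walks to the rays and anti-rays makes them one-ended. *)

(** * Stable matchings of paths with rays *)

(* [M i p j z] stands for: the p-th vertex of path i is the z-th vertex of ray j.
   Path i proposes to the rays it meets in the order of p, and ray j prefers
   larger z; in the limit a path may run through all its proposals. *)
Section StableMatching.
Variables (n : nat) (M : nat -> nat -> nat -> int -> Prop).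
Hypothesis Mdom : forall i p j z, M i p j z -> i < n.
Hypothesis Mfun : forall i p j z j' z', M i p j z -> M i p j' z' -> j = j' /\ z = z'.

(** A path that meets no ray at its current position is unstable vacuously, so that it simply moves
    on. *)
Definition unstable (s : nat -> nat) i : Prop :=
  forall j z, M i (s i) j z -> exists i' z', M i' (s i') j z' /\ (z < z')%R.

Definition advance (s : nat -> nat) i := if `[< unstable s i >] then (s i).+1 else s i.

Fixpoint stage t : nat -> nat := if t is t.+1 then advance (stage t) else fun=> 0.

Lemma stage_mono i t t' : t <= t' -> stage t i <= stage t' i.
Proof.
elim: t' => [|t' IH]; first by rewrite leqn0 => /eqP ->.
rewrite leq_eqVlt => /orP[/eqP -> //|/IH h]; apply: leq_trans h _.
by rewrite /= /advance; case: ifP.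
Qed.

(** Only n paths propose, so some current proposal to j is maximal. By [Mfun] its path proposes
    nowhere else at that position, hence is not unstable. *)
Lemma best_proposer (s : nat -> nat) j i z : M i (s i) j z ->
  exists i' z', [/\ M i' (s i') j z', (z <= z')%R & ~ unstable s i'].
Proof.
move=> Mi.
have [i' [z' [Mi' zmax]]] : exists i' z', M i' (s i') j z' /\
    forall i'' z'', i'' < n -> M i'' (s i'') j z'' -> (z'' <= z')%R.
  have : exists i' z', M i' (s i') j z' /\
      forall i'' z'', i'' < 0 -> M i'' (s i'') j z'' -> (z'' <= z')%R.
    by exists i, z.
  elim: n => [//|m IH] /IH [i' [z' [Mi' zmax]]].
  have [[y [My yz]]|no] := pselect (exists y, M m (s m) j y /\ (z' < y)%R).
    exists m, y; split=> // i'' z''; rewrite ltnS leq_eqVlt => /orP[/eqP ->|lt] Mz.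
      by have [_ ->] := Mfun My Mz.
    by have := zmax _ _ lt Mz; lia.
  exists i', z'; split=> // i'' z''; rewrite ltnS leq_eqVlt => /orP[/eqP ->|lt] Mz.
    by rewrite leNgt; apply/negP => h; apply: no; exists z''.
  exact: zmax lt Mz.
exists i', z'; split => //; first exact: zmax (Mdom Mi) Mi.
move=> /(_ j z' Mi') [i'' [z'' [Mi'' lt]]].
by have := zmax _ _ (Mdom Mi'') Mi''; lia.
Qed.

(** The best proposer keeps its place, so what a ray holds never gets worse. *)
Lemma engaged_step t j i z : M i (stage t i) j z ->
  exists i' z', M i' (stage t.+1 i') j z' /\ (z <= z')%R.
Proof.
move=> /best_proposer [i' [z' [Mi' zz' st]]]; exists i', z'; split => //.
by rewrite /= /advance; case: asboolP.
Qed.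

(** A path leaves p only after being outbid there, and by [engaged_step] the winning bid does not
    deteriorate later. *)
Lemma passed_rejected t i p j z : p < stage t i -> M i p j z ->
  exists i' z', M i' (stage t i') j z' /\ (z < z')%R.
Proof.
elim: t i p z => [//|t IH] i p z lt Mi.
suff [i' [z' [Mi' zz']]] : exists i' z', M i' (stage t i') j z' /\ (z < z')%R.
  have [i'' [z'' [? ?]]] := engaged_step Mi'.
  by exists i'', z''; split=> //; lia.
have [lt'|ge] := ltnP p (stage t i); first exact: IH Mi.
move: lt; rewrite /= /advance; case: asboolP => [un|_]; last by rewrite ltnNge ge.
rewrite ltnS => le; have e : p = stage t i by apply/eqP; rewrite eqn_leq le ge.
by apply: un; rewrite -e.
Qed.

Definition halts i s := exists t0, forall t, t0 <= t -> stage t i = s.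

(** [None] stands for a path that advances forever; as positions only increase, there is no third
    behaviour. *)
Definition stop i : option nat :=
  if pselect (exists s, halts i s) is left h then Some (projT1 (cid h)) else None.

Lemma stop_some i s : stop i = Some s -> halts i s.
Proof. by rewrite /stop; case: pselect => // h [<-]; case: cid. Qed.

Lemma stop_none i : stop i = None -> forall p, exists t, p < stage t i.
Proof.
rewrite /stop; case: pselect => // h _; elim => [|p [t pt]].
  apply: contrapT => no; apply: h; exists 0, 0 => t _.
  by apply/eqP; rewrite -leqn0 leqNgt; apply/negP => ?; apply: no; exists t.
apply: contrapT => no; apply: h; exists (stage t i), t => t' tt'.
apply/eqP; rewrite eqn_leq (stage_mono i tt') andbT leqNgt; apply/negP => lt.
by apply: no; exists t'; apply: leq_ltn_trans pt lt.
Qed.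

Definition live (st : nat -> option nat) i p : Prop := if st i is Some s then p <= s else true.

Lemma live_stage i p : live stop i p -> exists t0, forall t, t0 <= t -> p <= stage t i.
Proof.
rewrite /live; case e: (stop i) => [s|].
  by have [t0 h] := stop_some e => ps; exists t0 => t /h ->.
move=> _; have [t pt] := stop_none e p; exists t => t' tt'.
by apply: leq_trans (ltnW pt) _; exact: stage_mono.
Qed.

Lemma stop_stable i s : stop i = Some s -> exists t0, forall t, t0 <= t ->
  stage t i = s /\ ~ unstable (stage t) i.
Proof.
move=> /stop_some [t0 h]; exists t0 => t tt; split; first exact: h.
move=> un; have := h t.+1 (leqW tt); have := h t tt.
by rewrite /= /advance; case: asboolP => // _ ->; lia.
Qed.

Lemma live_engaged i p j z : live stop i p -> M i p j z ->
  exists t0, forall t, t0 <= t -> exists i' z', M i' (stage t i') j z' /\ (z <= z')%R.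
Proof.
move=> /live_stage [t0 h] Mi; exists t0 => t tt.
have := h t tt; rewrite leq_eqVlt => /orP[/eqP e|lt]; first by exists i, z; rewrite -e.
by have [i' [z' [? ?]]] := passed_rejected lt Mi; exists i', z'; split => //; lia.
Qed.

(** A ray touched at a live position holds a proposal at every late stage, and distinct rays hold
    distinct paths, whence the bound n. If all meetings occur at bounded positions, the path held at
    a late stage must have stopped. *)
Lemma stable_matching : exists (st : nat -> option nat) (tg : nat -> nat) (ps : nat -> int),
  [/\ forall i s, st i = Some s -> M i s (tg i) (ps i),
      forall i s i' p z, st i = Some s -> live st i' p -> M i' p (tg i) z -> (z <= ps i)%R,
      forall s : seq nat, uniq s ->
        (forall j, j \in s -> exists i p z, live st i p /\ M i p j z) -> size s <= n
    & (exists l, forall i p j z, M i p j z -> p <= l) ->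
        forall i p j z, live st i p -> M i p j z ->
          exists i', [/\ i' < n, st i' <> None & tg i' = j]].
Proof.
(* A stopped path is not unstable, so it does meet a ray where it stops; [(0, 0%R)] is a filler for
   paths that never stop. *)
have h i : exists jz : nat * int, forall s, stop i = Some s ->
    M i s jz.1 jz.2.
  case e: (stop i) => [s|]; last by exists (0, 0%R).
  have [t0 /(_ t0 (leqnn _)) [ts nun]] := stop_stable e.
  apply: contrapT => no; apply: nun => j z; rewrite ts => Mi; exfalso; apply: no.
  by exists (j, z) => _ [<-].
have [f Hf] := choice h.
exists stop, (fun i => (f i).1), (fun i => (f i).2); split.
- by move=> i s /Hf.
- move=> i s i' p z e lv Mi'.
  have [t1 h1] := stop_stable e; have [t2 h2] := live_engaged lv Mi'.
  have [] := h1 (maxn t1 t2); first by rewrite leq_maxl.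
  have [] := h2 (maxn t1 t2); first by rewrite leq_maxr.
  move=> i'' [z'' [M'' le]] ts nun; have Mi := Hf _ _ e.
  rewrite leNgt; apply/negP => lt; apply: nun => j y; rewrite ts => Mi2.
  have [<- <-] := Mfun Mi Mi2; exists i'', z''; split => //; lia.
- move=> s us tch.
  have [t ht] : exists t, forall t' j, t <= t' -> j \in s ->
      exists i z, M i (stage t' i) j z.
    elim: s tch {us} => [|j s IH] tch; first by exists 0.
    have [|t ht] := IH; first by move=> j' js; apply: tch; rewrite inE js orbT.
    have [|i [p [z [lv Mi]]]] := tch j; first by rewrite inE eqxx.
    have [t0 h0] := live_engaged lv Mi; exists (maxn t t0) => t' j'.
    rewrite geq_max => /andP[tt t0t]; rewrite inE => /orP[/eqP ->|/ht]; last exact.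
    by have [i' [z' [? ?]]] := h0 _ t0t; exists i', z'.
  have h' j : exists i, j \in s -> exists z, M i (stage t i) j z.
    have [js|] := boolP (j \in s); last by exists 0.
    by have [i [z ?]] := ht t j (leqnn _) js; exists i => _; exists z.
  have [g Hg] := choice h'.
  rewrite -(size_map g) -[leqRHS](size_iota 0); apply: uniq_leq_size.
    rewrite map_inj_in_uniq // => j j' /Hg [z Mz] /Hg [z' Mz'] e.
    by rewrite e in Mz; have [] := Mfun Mz Mz'.
  by move=> _ /mapP [j /Hg [z /Mdom ?] ->]; rewrite mem_iota.
- move=> [l Ml] i p j z lv Mi.
  have [t0 h0] := live_engaged lv Mi.
  (* By stage t every path has reached its stop or has passed l, beyond which there are no
     meetings. *)
  have [t [t0t ht]] : exists t, t0 <= t /\ forall i t', i < n -> t <= t' ->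
      if stop i is Some s then stage t' i = s else l < stage t' i.
    elim: {1}n => [|m [t [t0t IH]]]; first by exists t0.
    have [t1 h1] : exists t1, forall t', t1 <= t' ->
        if stop m is Some s then stage t' m = s else l < stage t' m.
      case e: (stop m) => [s|]; first exact: stop_some e.
      have [t1 h1] := stop_none e l; exists t1 => t' ?.
      by apply: leq_trans h1 _; exact: stage_mono.
    exists (maxn t t1); split; first by rewrite leq_max t0t.
    move=> k t'; rewrite ltnS leq_eqVlt geq_max => + /andP[? ?].
    by move=> /orP[/eqP ->|?]; [exact: h1 | exact: IH].
  have [i' [z' [Mi' _]]] := h0 t t0t.
  have := ht i' t (Mdom Mi') (leqnn _).
  case e: (stop i') => [s|]; last by have := Ml _ _ _ _ Mi'; lia.
  move=> ts; exists i'; split => //; [exact: Mdom Mi' | by rewrite e|].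
  by rewrite ts in Mi'; have [] := Mfun (Hf _ _ e) Mi'.
Qed.

End StableMatching.

(** * Rerouting rays *)

Section Rerouting.
Variables (V : Type) (E : V -> V -> Prop).

Definition rays (K : set nat) (f : nat -> nat -> V) : Prop :=
  (forall i p, K i -> E (f i p) (f i p.+1)) /\
  (forall i j p q, K i -> K j -> f i p = f j q -> i = j /\ p = q).

Section General.
Variables (n N : nat) (f : nat -> nat -> V) (t : nat -> int -> V).
Variables (P : nat -> nat -> Prop) (Dom : int -> Prop).
Hypothesis Pdown : forall i p q, p <= q -> P i q -> P i p.
Hypothesis Dup : forall y z, (y <= z)%R -> Dom y -> Dom z.
Hypothesis fstep : forall i p, i < n -> P i p.+1 -> E (f i p) (f i p.+1).
Hypothesis finj : forall i j p q, i < n -> j < n -> P i p -> P j q ->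
  f i p = f j q -> i = j /\ p = q.
Hypothesis tstep : forall j z, j < N -> Dom z -> E (t j z) (t j (z + 1)%R).
Hypothesis tinj : forall j k y z, j < N -> k < N -> Dom y -> Dom z ->
  t j y = t k z -> j = k /\ y = z.

(** [P i p] says that path i has a p-th vertex, which admits finite paths; [Dom] lets the targets be
    rays or double rays. *)
Definition meet i p j z := [/\ i < n, P i p, j < N, Dom z & f i p = t j z].

(** Each path is followed up to its stop and continues on its matched ray from there. Stability
    keeps these tails clear of the live parts of all paths and prevents two paths from sharing a
    ray. *)
Lemma reroute_general : exists (st : nat -> option nat) (tg : nat -> nat) (g : nat -> nat -> V),
  let ok i := i < n /\ (st i <> None \/ forall p, P i p) in
  [/\ rays ok g,
      forall i s, st i = Some s ->
        [/\ i < n, P i s & forall p, s <= p -> exists z, [/\ tg i < N, Dom z & g i p = t (tg i) z]],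
      forall i p, ok i -> live st i p -> g i p = f i p,
      forall s : seq nat, uniq s ->
        (forall j, j \in s -> exists i p z, [/\ ok i, j < N, Dom z & g i p = t j z]) ->
        size s <= n
    & (exists l, forall i p, P i p -> p <= l) ->
        forall i p j z, live st i p -> meet i p j z ->
          exists i', [/\ i' < n, st i' <> None & tg i' = j]].
Proof.
have [||st [tg [ps [st_meet st_best st_touch st_bound]]]] := @stable_matching n meet.
- by move=> i p j z [].
- by move=> i p j z j' z' [_ _ jN dz e1] [_ _ jN' dz' e2]; apply: tinj => //; rewrite -e1.
pose g i p := if st i is Some s then
    if p < s then f i p else t (tg i) (ps i + (p - s)%:Z)%R else f i p.
(* A finite path that never stops yields no ray and is left out. *)
pose ok i := i < n /\ (st i <> None \/ forall p, P i p).
have gstop i s p : st i = Some s -> s <= p -> g i p = t (tg i) (ps i + (p - s)%:Z)%R.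
  by rewrite /g => -> sp; rewrite ltnNge sp.
have glive i p : live st i p -> g i p = f i p.
  rewrite /live /g; case e: (st i) => [s|//].
  rewrite leq_eqVlt => /orP[/eqP ->|->//].
  by rewrite ltnn subnn addr0; have [_ _ _ _ ->] := st_meet _ _ e.
have Pok i p : ok i -> live st i p -> P i p.
  move=> [_ h]; rewrite /live; case e: (st i) h => [s|] h ps'.
    by have [_ ? _ _ _] := st_meet _ _ e; apply: Pdown ps' _.
  by case: h.
have spec i p : ok i -> (live st i p /\ g i p = f i p) \/
    exists s, [/\ st i = Some s, s < p & g i p = t (tg i) (ps i + (p - s)%:Z)%R].
  move=> oki; rewrite /g /live; case e: (st i) => [s|]; last by left.
  have [ps'|sp] := leqP p s; last by right; exists s; split=> //; rewrite ltnNge (ltnW sp).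
  by left; split=> //; have := glive i p; rewrite /live /g e => ->.
have Dt i s p : st i = Some s -> Dom (ps i + (p - s)%:Z)%R.
  by move=> /st_meet [_ _ _ dz _]; apply: Dup dz; lia.
(* A live vertex strictly inside a tail taken over would be a meeting that the ray prefers to the
   one it accepted. *)
have cross i i' p p' s : ok i -> live st i p -> st i' = Some s -> s < p' ->
    f i p = t (tg i') (ps i' + (p' - s)%:Z)%R -> False.
  move=> oki lv e lt fe; have [_ _ tN _ _] := st_meet _ _ e.
  have : meet i p (tg i') (ps i' + (p' - s)%:Z)%R.
    by split=> //; [case: oki | exact: Pok | exact: Dt].
  by move/(st_best _ _ _ _ _ e lv); lia.
exists st, tg, g; split.
- split=> [i p oki|i i' p p' oki oki' e].
    have [[lv ->]|[s [e sp ->]]] := spec i p oki; last first.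
      have [_ _ tN dz _] := st_meet _ _ e.
      rewrite (gstop _ _ _ e) ?leqW 1?ltnW // subSn 1?ltnW //.
      rewrite -addn1 PoszD addrA; apply: tstep => //; exact: Dt.
    have [[lv' ->]|[s [e sp ->]]] := spec i p.+1 oki.
      by apply: fstep; [case: oki | exact: Pok].
    (* At the switch the next arc is already the first arc of the tail taken over. *)
    have ps' : p = s.
      by move: lv; rewrite /live e => ?; apply/eqP; rewrite eqn_leq; apply/andP.
    subst s; have [_ _ tN dz ->] := st_meet _ _ e.
    by rewrite subSnn; apply: tstep.
  have [[lv ge]|[s [es sp ge]]] := spec i p oki;
      have [[lv' ge']|[s' [es' sp' ge']]] := spec i' p' oki'.
  + apply: finj; [by case: oki | by case: oki' | exact: Pok | exact: Pok |].
    by rewrite -ge e.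
  + by case: (@cross i i' p p' s') => //; rewrite -ge e.
  + by case: (@cross i' i p' p s) => //; rewrite -ge' -e.
  have := st_meet _ _ es; have := st_meet _ _ es'.
  move=> [i'n Ps' tN' dz' fe'] [i_n Ps tN dz fe].
  have [te pe] : tg i = tg i' /\ (ps i + (p - s)%:Z = ps i' + (p' - s')%:Z)%R.
    by apply: tinj => //; [exact: Dt|exact: Dt|rewrite -ge -ge'].
  (* Two paths on one ray bound each other's accepted place, so they stop at the same vertex and
     coincide. *)
  have le1 : (ps i <= ps i')%R.
    apply: (st_best i' s' i s _ es'); first by rewrite /live es.
    by rewrite -te.
  have le2 : (ps i' <= ps i)%R.
    apply: (st_best i s i' s' _ es); first by rewrite /live es'.
    by rewrite te.
  have [ii ss] : i = i' /\ s = s'.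
    by apply: finj => //; rewrite fe fe' te; congr (t _ _); lia.
  by split=> //; lia.
- move=> i s e; have [i_n Ps tN dz fe] := st_meet _ _ e; split => // p sp.
  by exists (ps i + (p - s)%:Z)%R; split=> //; [exact: Dt | exact: gstop].
- by move=> i p _ /glive.
- move=> s us h; apply: st_touch => // j /h [i [p [z [oki jN dz ge]]]].
  have [[lv e]|[s' [es sp e]]] := spec i p oki.
    exists i, p, z; split=> //; split=> //; [by case: oki|exact: Pok|by rewrite -e].
  have M := st_meet _ _ es; have [_ _ tN _ _] := M.
  have [<- _] : tg i = j /\ (ps i + (p - s')%:Z)%R = z.
    by apply: tinj => //; [exact: Dt | rewrite -e -ge].
  by exists i, s', (ps i); split=> //; rewrite /live es.
- move=> [l Pl]; apply: st_bound; exists l => i p j z [_ /Pl]; exact.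
Qed.
End General.

(** All paths are infinite, so each yields a ray whether it stops or not. A stop lies on a target,
    hence after every initial segment that misses the targets. *)
Lemma reroute n N (f : nat -> nat -> V) (t : nat -> int -> V) (Dom : int -> Prop) :
  (forall y z, (y <= z)%R -> Dom y -> Dom z) ->
  rays `I_n f ->
  (forall j z, j < N -> Dom z -> E (t j z) (t j (z + 1)%R)) ->
  (forall j k y z, j < N -> k < N -> Dom y -> Dom z -> t j y = t k z -> j = k /\ y = z) ->
  exists g, [/\ rays `I_n g,
    forall i p, i < n -> (forall q j z, q <= p -> j < N -> Dom z -> f i q <> t j z) ->
      g i p = f i p,
    forall i p, i < n -> (exists q, g i p = f i q) \/
      exists j z, [/\ j < N, Dom z & g i p = t j z]
    & forall s : seq nat, uniq s ->
        (forall j, j \in s -> exists i p z, [/\ i < n, j < N, Dom z & g i p = t j z]) ->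
        size s <= n].
Proof.
move=> Dup [fstep finj] tstep tinj.
have [|||st [tg [g [gr gstop glive touch _]]]] :=
  @reroute_general n N f t (fun _ _ => True) Dom _ Dup _ _ tstep tinj.
- by [].
- by move=> i p i_n _; apply: fstep.
- by move=> *; apply: finj.
exists g; split.
- case: gr => h1 h2; split=> [i p ?|i j p q ? ?]; first by apply: h1; split=> //; right.
  by apply: h2; split=> //; right.
- move=> i p i_n free; apply: (glive); first by split=> //; right.
  rewrite /live; case e: (st i) => [s|//]; rewrite leqNgt; apply/negP => sp.
  have [_ _ /(_ s (leqnn _)) [z [tN dz ge]]] := gstop _ _ e.
  apply: (free s (tg i) z) => //; first exact: ltnW.
  by rewrite -ge; apply/esym/glive; [split=> //; right | rewrite /live e].
- move=> i p i_n; case e: (st i) => [s|].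
    have [_ _ h] := gstop _ _ e; have [/h [z ?]|ps] := leqP s p.
      by right; exists (tg i), z.
    left; exists p; apply: (glive); first by split=> //; right.
    by rewrite /live e ltnW.
  by left; exists p; apply: (glive); [split=> //; right | rewrite /live e].
- move=> s us h; apply: touch => // j /h [i [p [z [? ? ? ?]]]].
  by exists i, p, z; split=> //; split=> //; right.
Qed.

(* The last vertex of an unmatched path lies on a ray that some other path has
   taken over, so at most half of the paths stay unmatched. *)
Lemma reroute_half h (f : nat -> nat -> V) (len : nat -> nat) (t : nat -> nat -> V) :
  (forall i p, i < h.*2 -> p < len i -> E (f i p) (f i p.+1)) ->
  (forall i j p q, i < h.*2 -> j < h.*2 -> p <= len i -> q <= len j ->
     f i p = f j q -> i = j /\ p = q) ->
  rays `I_(h.*2) t ->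
  (forall i, i < h.*2 -> exists c, f i (len i) = t i c) ->
  exists (a : nat -> nat) (s : nat -> nat) (g : nat -> nat -> V),
    [/\ forall i j, i < h -> j < h -> a i = a j -> i = j,
        forall i, i < h -> a i < h.*2 /\ s i <= len (a i),
        rays `I_h g,
        forall i p, i < h -> p <= s i -> g i p = f (a i) p
      & forall i p, i < h -> s i <= p -> exists j c, j < h.*2 /\ g i p = t j c].
Proof.
move=> fstep finj [tstep tinj] fend.
(* The rays [t] are indexed by integers through the absolute value, cut down to nonnegative ones. *)
have [||||||st [tg [g [gr gstop glive _ bound]]]] :=
  @reroute_general h.*2 h.*2 f (fun j z => t j `|z|%N)
    (fun i p => i < h.*2 /\ p <= len i) (fun z => (0 <= z)%R).
- by move=> i p q pq [? ?]; split=> //; apply: leq_trans pq _.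
- by move=> y z; lia.
- by move=> i p ? [_ ?]; apply: fstep.
- by move=> i j p q ? ? [_ ?] [_ ?]; apply: finj.
- move=> j z jn z0; have -> : `|(z + 1)%R|%N = (`|z|%N).+1 by lia.
  exact: tstep.
- move=> j k y z jn kn y0 z0 /tinj [] // -> e; split=> //; lia.
(* Finitely many finite paths have bounded length, which gives access to the last clause of
   [reroute_general]: every ray met is taken over. *)
have bd : exists l, forall i p, i < h.*2 /\ p <= len i -> p <= l.
  exists (\max_(i < h.*2) len i) => i p [ih pl]; apply: leq_trans pl _.
  exact: (leq_bigmax (Ordinal ih)).
pose A := [seq i <- iota 0 h.*2 | st i != None].
pose B := [seq i <- iota 0 h.*2 | st i == None].
have sAB : size A + size B = h.*2.
  rewrite !size_filter addnC -[RHS](size_iota 0) -(count_predC (fun i => st i == None)).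
  by congr (_ + _).
have sBA : size B <= size A.
  rewrite -(size_map tg A); apply: uniq_leq_size; first by rewrite filter_uniq ?iota_uniq.
  move=> i; rewrite mem_filter mem_iota add0n => /andP[/eqP e ih].
  have [c fc] := fend i ih.
  have [||i' [i'n st' <-]] := bound bd i (len i) i (Posz c).
  - by rewrite /live e.
  - by split=> //; split=> //; rewrite fc.
  by apply: map_f; rewrite mem_filter mem_iota add0n i'n; apply/andP; split=> //; apply/eqP.
have hA : h <= size A by lia.
have Ai i : i < h -> nth 0 A i < h.*2 /\ st (nth 0 A i) <> None.
  move=> ih; have : nth 0 A i \in A by apply: mem_nth; exact: leq_trans ih hA.
  by rewrite mem_filter mem_iota add0n => /andP[/eqP ? ?].
have sAi i : exists s, i < h -> st (nth 0 A i) = Some s.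
  have [/Ai [_]|?] := ltnP i h; last by exists 0.
  by case: (st _) => // s _; exists s.
have [s sE] := choice sAi.
have ok i : i < h -> nth 0 A i < h.*2 /\ (st (nth 0 A i) <> None \/
    forall p, nth 0 A i < h.*2 /\ p <= len (nth 0 A i)).
  by move=> /Ai [? ?]; split=> //; left.
have Ainj i j : i < h -> j < h -> nth 0 A i = nth 0 A j -> i = j.
  move=> ih jh /eqP.
  rewrite nth_uniq ?filter_uniq ?iota_uniq ?(leq_trans ih hA) ?(leq_trans jh hA) //.
  by move/eqP.
exists (fun i => nth 0 A i), s, (fun i => g (nth 0 A i)); split.
- exact: Ainj.
- move=> i ih; have [? [_ ?] _] := gstop _ _ (sE i ih); by split.
- case: gr => g1 g2; split=> [i p ih|i j p q ih jh e]; first by apply: g1; exact: ok.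
  by have [/Ainj ->] := g2 _ _ _ _ (ok i ih) (ok j jh) e.
- move=> i p ih ps; apply: (glive); first exact: ok.
  by rewrite /live sE.
- move=> i p ih ps; have [_ _ /(_ p ps) [z [? ? ?]]] := gstop _ _ (sE i ih).
  by exists (tg (nth 0 A i)), `|z|%N.
Qed.
End Rerouting.

(** * Packings of rays and anti-rays *)

Lemma dependent_choice T (Inv : nat -> T -> Prop) (R : nat -> T -> T -> Prop) :
  (exists x, Inv 0 x) ->
  (forall n x, Inv n x -> exists y, Inv n.+1 y /\ R n x y) ->
  exists u : nat -> T, forall n, Inv n (u n) /\ R n (u n) (u n.+1).
Proof.
move=> [x0 h0] h.
have h' (nx : nat * T) : exists y, Inv nx.1 nx.2 -> Inv nx.1.+1 y /\ R nx.1 nx.2 y.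
  have [/h [y ?]|?] := pselect (Inv nx.1 nx.2); first by exists y.
  by exists nx.2.
have [f Hf] := choice h'.
pose u := fix u n := if n is n.+1 then f (n, u n) else x0.
have Iu n : Inv n (u n).
  elim: n => [//|n IH]; exact: (Hf (n, u n) IH).1.
by exists u => n; split=> //; exact: (Hf (n, u n) (Iu n)).2.
Qed.

(** Serves constructions in which each new object has to avoid all earlier ones. *)
Lemma history_choice T (P : seq T -> T -> Prop) :
  (forall s, exists x, P s x) -> exists u : nat -> T, forall n, P (mkseq u n) (u n).
Proof.
move=> /choice [f Hf].
pose g n := iter n (fun s => rcons s (f s)) [::].
exists (fun n => f (g n)) => n.
suff -> : mkseq (fun n => f (g n)) n = g n by [].
by elim: n => [//|n IH]; rewrite mkseqS IH.
Qed.

Lemma finite_set_elim T (P : set T -> Prop) :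
  P set0 -> (forall x X, P X -> P (x |` X)) -> forall X, finite_set X -> P X.
Proof.
elim/Pchoice: T => T in P * => P0 PS X /finite_seqP [s ->].
elim: s => [|x s IH]; first by rewrite set_nil.
suff -> : [set` x :: s] = x |` [set` s] by exact: PS.
apply/seteqP; split=> y /=; rewrite inE; first by case/orP=> [/eqP|]; [left|right].
by case=> [->|->]; rewrite ?eqxx ?orbT.
Qed.

Section Packings.
Variable V : Type.
Implicit Types (E L : V -> V -> Prop) (K : set nat) (o : nat -> int -> V) (S U W X Z : set V).

Definition flip E : V -> V -> Prop := fun u v => E v u.

(* [o i] places the ray on the nonnegative integers and the anti-ray on the
   negative ones, [Negz 0 = -1] being the last vertex of the anti-ray. Taking
   [L = E] joins them to a double ray; [L = True] leaves them unrelated. *)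
Definition packing E L K o : Prop :=
  [/\ rays E K (fun i p => o i (Posz p)),
      rays (flip E) K (fun i p => o i (Negz p)),
      forall i j p q, K i -> K j -> o i (Posz p) <> o j (Negz q)
    & forall i, K i -> L (o i (Negz 0)) (o i (Posz 0))].

Definition mix (a r : nat -> nat -> V) : nat -> int -> V :=
  fun i z => match z with Posz p => r i p | Negz p => a i p end.

Lemma packing_inj E L K o i j y z : packing E L K o -> K i -> K j ->
  o i y = o j z -> i = j /\ y = z.
Proof.
move=> [[_ r] [_ a] d _] Ki Kj.
case: y z => [p|p] [q|q] e.
- by have [-> ->] := r _ _ _ _ Ki Kj e.
- by case: (d _ _ _ _ Ki Kj e).
- by case: (d _ _ _ _ Kj Ki (esym e)).
- by have [-> ->] := a _ _ _ _ Ki Kj e.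
Qed.

Lemma packing_step E K o i z : packing E E K o -> K i -> E (o i z) (o i (z + 1)%R).
Proof.
move=> [[r _] [a _] _ l] Ki; case: z => [p|[|p]].
- have -> : (Posz p + 1)%R = Posz p.+1 by lia.
  exact: r.
- exact: l.
- have -> : (Negz p.+1 + 1)%R = Negz p by lia.
  exact: a.
Qed.

Lemma packingI E L K o :
  (forall i p, K i -> E (o i (Posz p)) (o i (Posz p.+1))) ->
  (forall i p, K i -> E (o i (Negz p.+1)) (o i (Negz p))) ->
  (forall i, K i -> L (o i (Negz 0)) (o i (Posz 0))) ->
  (forall i j y z, K i -> K j -> o i y = o j z -> i = j /\ y = z) ->
  packing E L K o.
Proof.
move=> r a l inj; split=> //.
- by split=> [i p Ki|i j p q Ki Kj /inj [] // -> [->] //]; exact: r.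
- by split=> [i p Ki|i j p q Ki Kj /inj [] // -> [->] //]; exact: a.
- by move=> i j p q Ki Kj /inj [].
Qed.

Lemma double_packing E K o :
  (forall i z, K i -> E (o i z) (o i (z + 1)%R)) ->
  (forall i j y z, K i -> K j -> o i y = o j z -> i = j /\ y = z) ->
  packing E E K o.
Proof.
move=> st inj; apply: packingI => // [i p Ki|i p Ki|i Ki].
- by have := st i (Posz p) Ki; rewrite -PoszD addn1.
- have := st i (Negz p.+1) Ki; suff -> : (Negz p.+1 + 1)%R = Negz p by [].
  by lia.
- by have := st i (Negz 0) Ki.
Qed.

Lemma rays_sub E K K' (h : nat -> nat) f :
  (forall i, K' i -> K (h i)) -> (forall i j, K' i -> K' j -> h i = h j -> i = j) ->
  rays E K f -> rays E K' (fun i => f (h i)).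
Proof.
move=> hK hinj [st inj]; split=> [i p /hK|i j p q Ki Kj e]; first exact: st.
by have [/hinj ->] := inj _ _ _ _ (hK _ Ki) (hK _ Kj) e.
Qed.

Lemma packing_sub E L K K' (h : nat -> nat) o :
  (forall i, K' i -> K (h i)) -> (forall i j, K' i -> K' j -> h i = h j -> i = j) ->
  packing E L K o -> packing E L K' (fun i => o (h i)).
Proof.
move=> hK hinj [r a d l]; split; [exact: rays_sub r|exact: rays_sub a| |].
  by move=> i j p q /hK ? /hK ?; exact: d.
by move=> i /hK ?; exact: l.
Qed.

Lemma rays_mono E E' K K' f : (forall u v, E u v -> E' u v) -> K' `<=` K ->
  rays E K f -> rays E' K' f.
Proof.
move=> EE KK [st inj]; split=> [i p /KK Ki|i j p q /KK Ki /KK Kj]; last exact: inj.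
by apply: EE; exact: st.
Qed.

Lemma packing_mono E E' L L' K K' o :
  (forall u v, E u v -> E' u v) -> (forall u v, L u v -> L' u v) -> K' `<=` K ->
  packing E L K o -> packing E' L' K' o.
Proof.
move=> EE LL KK [r a d l]; split.
- exact: rays_mono r.
- by apply: rays_mono a => // u v; apply: EE.
- by move=> i j p q /KK ? /KK ?; exact: d.
- by move=> i /KK ?; apply/LL/l.
Qed.

Lemma rays_extend E n f x : rays E `I_n f ->
  (forall p, E (x p) (x p.+1)) -> injective x -> (forall i p q, i < n -> f i p <> x q) ->
  rays E `I_n.+1 (fun i => if i < n then f i else x).
Proof.
move=> [st inj] xst xinj d; split=> [i p _|i j p q /= iN jN].
  by case: ifP => // ?; apply: st.
case: (ltnP i n) => ni; case: (ltnP j n) => nj.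
- exact: inj.
- by move=> /d [].
- by move=> /esym /d [].
- by move=> /xinj ->; split=> //; lia.
Qed.

Definition unbounded_packing E L : Prop := forall n, exists o, packing E L `I_n o.
Definition infinite_packing E L : Prop := exists o, packing E L setT o.

(** The reflection [- 1 - z] exchanges [Posz p] and [Negz p]. *)
Lemma packing_flip E K o : packing E E K o ->
  packing (flip E) (flip E) K (fun i z => o i (- 1 - z)%R).
Proof.
move=> pk; apply: double_packing => [i z Ki|i j y z Ki Kj e].
  have := packing_step (- 1 - (z + 1))%R pk Ki.
  by have -> : (- 1 - (z + 1) + 1 = - 1 - z)%R by lia.
by have [-> ?] := packing_inj pk Ki Kj e; split=> //; lia.
Qed.

Lemma packing_shift E K o (h : nat -> int) : packing E E K o ->
  packing E E K (fun i z => o i (z + h i)%R).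
Proof.
move=> pk; apply: double_packing => [i z Ki|i j y z Ki Kj e].
  have := packing_step (z + h i)%R pk Ki.
  by have -> : (z + h i + 1 = z + 1 + h i)%R by lia.
have [ij ?] := packing_inj pk Ki Kj e; split=> //; subst j; lia.
Qed.

(** Every vertex is eventually frozen, and each condition on a packing involves only finitely many
    vertices, so it passes to the limit. *)
Lemma limit_packing E L (Inv : nat -> (nat -> int -> V) -> Prop) :
  (exists o, Inv 0 o) ->
  (forall n o, Inv n o -> packing E L `I_n o) ->
  (forall n o, Inv n o -> exists o', Inv n.+1 o' /\
     forall i z, i < n -> `|z|%N <= n -> o' i z = o i z) ->
  infinite_packing E L.
Proof.
move=> h0 hpk /(dependent_choice h0) [u Hu].
(* From stage [(i + |z|).+1] on the vertex [(i, z)] no longer changes. *)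
pose g i z := u (i + `|z|%N).+1 i z.
have gE i z n : i + `|z|%N < n -> u n i z = g i z.
  elim: n => [//|n IH]; rewrite ltnS leq_eqVlt => /orP[/eqP <- //|lt].
  by rewrite -(IH lt); apply: (Hu n).2; lia.
have pk n := hpk _ _ (Hu n).1.
exists g; split.
- split=> [i p _|i j p q _ _ e].
    have [[st _] _ _ _] := pk (i + p).+2; have := st i p.
    by rewrite /= !gE /=; [apply; lia|lia|lia].
  pose n := (i + j + p + q).+2.
  have [[_ inj] _ _ _] := pk n; apply: inj; rewrite /= ?gE //; rewrite /n /=; lia.
- split=> [i p _|i j p q _ _ e].
    have [_ [st _] _ _] := pk (i + p).+4; have := st i p.
    by rewrite /= !gE /=; [apply; lia|lia|lia].
  pose n := (i + j + p + q).+4.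
  have [_ [_ inj] _ _] := pk n; apply: inj; rewrite /= ?gE //; rewrite /n /=; lia.
- move=> i j p q _ _ e; pose n := (i + j + p + q).+4.
  by have [_ _ d _] := pk n; apply: (d i j p q); rewrite /= ?gE //; rewrite /n /=; lia.
- move=> i _; have [_ _ _ l] := pk i.+2; have := l i.
  by rewrite /= !gE /=; [apply; lia|lia|lia].
Qed.

(* P holds for all but boundedly many members of every packing. *)
Definition most E L (P : (int -> V) -> Prop) : Prop :=
  exists m, forall o, packing E L `I_m o -> exists2 i, i < m & P (o i).

Lemma not_most E L P : ~ most E L P -> forall m, exists o, packing E L `I_m o /\
  forall i, i < m -> ~ P (o i).
Proof.
move=> nm m; apply: contrapT => no; apply: nm; exists m => o pk.
apply: contrapT => no'; apply: no; exists o; split=> // i im Pi.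
by apply: no'; exists i.
Qed.

(** Members that fail P form a packing of their own, so fewer than m of them exist and N + m members
    leave N good ones. *)
Lemma select_most E L P N : most E L P -> exists m, forall o, packing E L `I_m o ->
  exists h : nat -> nat, [/\ forall i, i < N -> h i < m,
    forall i j, i < N -> j < N -> h i = h j -> i = j & forall i, i < N -> P (o (h i))].
Proof.
move=> [m Hm]; exists (N + m) => o pk.
pose A := [seq i <- iota 0 (N + m) | `[< P (o i) >]].
pose B := [seq i <- iota 0 (N + m) | ~~ `[< P (o i) >]].
have sAB : size A + size B = N + m.
  rewrite !size_filter -[RHS](size_iota 0) -(count_predC (fun i => `[< P (o i) >])).
  by congr (_ + _).
have [NA|AN] := leqP N (size A).
  exists (fun i => nth 0 A i); split=> [i iN|i j iN jN /eqP|i iN].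
  - have : nth 0 A i \in A by apply: mem_nth; exact: leq_trans iN NA.
    by rewrite mem_filter mem_iota add0n => /andP[].
  - by rewrite nth_uniq ?filter_uniq ?iota_uniq ?(leq_trans iN NA) ?(leq_trans jN NA) // => /eqP.
  - have : nth 0 A i \in A by apply: mem_nth; exact: leq_trans iN NA.
    by rewrite mem_filter => /andP[/asboolP].
have mB : m <= size B by lia.
have inB i : i < m -> nth 0 B i \in B.
  by move=> im; apply: mem_nth; exact: leq_trans im mB.
have pkB : packing E L `I_m (fun i => o (nth 0 B i)).
  apply: (packing_sub _ _ pk) => [i /inB|i j im jm /eqP].
    by rewrite mem_filter mem_iota add0n => /andP[].
  by rewrite nth_uniq ?filter_uniq ?iota_uniq ?(leq_trans im mB) ?(leq_trans jm mB) // => /eqP.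
have [i im Pi] := Hm _ pkB.
by have := inB _ im; rewrite mem_filter => /andP[/asboolP].
Qed.

Lemma most_and E L P Q : most E L P -> most E L Q -> most E L (fun d => P d /\ Q d).
Proof.
move=> mP [m Hm]; have [m' Hm'] := select_most m mP.
exists m' => o pk; have [h [hm hinj hP]] := Hm' o pk.
have [i im Qi] := Hm (fun i => o (h i)) (packing_sub hm hinj pk).
by exists (h i); [exact: hm | split=> //; exact: hP].
Qed.

Lemma most_mono E L P Q : (forall d, P d -> Q d) -> most E L P -> most E L Q.
Proof. by move=> PQ [m Hm]; exists m => o /Hm [i im /PQ]; exists i. Qed.

Lemma most_unbounded E L P N : unbounded_packing E L -> most E L P ->
  exists o, packing E L `I_N o /\ forall i, i < N -> P (o i).
Proof.
move=> ub /(select_most N) [m Hm]; have [o pk] := ub m.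
have [h [hm hinj hP]] := Hm o pk.
by exists (fun i => o (h i)); split=> //; exact: packing_sub pk.
Qed.

Definition avoids Z (d : int -> V) := forall z, ~ Z (d z).

Lemma most_avoids1 E L x : most E L (avoids [set x]).
Proof.
exists 2 => o pk; apply: contrapT => no.
have h i : i < 2 -> exists z, o i z = x.
  by move=> i2; apply: contrapT => nz; apply: no; exists i => // z e; apply: nz; exists z.
have [[y ey] [z ez]] := (h 0 isT, h 1 isT).
by have [] := packing_inj pk (isT : `I_2 0) (isT : `I_2 1) (etrans ey (esym ez)).
Qed.

Lemma most_avoids_finite E L X : finite_set X -> most E L (avoids X).
Proof.
move: X; apply: finite_set_elim => [|x X mX]; first by exists 1 => o _; exists 0 => // z [].
by apply: most_mono (most_and (most_avoids1 E L x) mX) => d [d1 dX] z [/d1|/dX].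
Qed.

End Packings.

(** Each of the two reroutings touches at most n of the 2n + 1 candidates. *)
Lemma untouched_index n (T1 T2 : nat -> Prop) :
  (forall s : seq nat, uniq s -> (forall j, j \in s -> T1 j) -> size s <= n) ->
  (forall s : seq nat, uniq s -> (forall j, j \in s -> T2 j) -> size s <= n) ->
  exists j, [/\ j < n + n.+1, ~ T1 j & ~ T2 j].
Proof.
move=> h1 h2; apply: contrapT => no.
pose s1 := [seq j <- iota 0 (n + n.+1) | `[< T1 j >]].
pose s2 := [seq j <- iota 0 (n + n.+1) | `[< T2 j >]].
have l1 : size s1 <= n.
  apply: h1 => [|j]; first by rewrite filter_uniq ?iota_uniq.
  by rewrite mem_filter => /andP[/asboolP].
have l2 : size s2 <= n.
  apply: h2 => [|j]; first by rewrite filter_uniq ?iota_uniq.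
  by rewrite mem_filter => /andP[/asboolP].
have : size (iota 0 (n + n.+1)) <= size (s1 ++ s2).
  apply: uniq_leq_size (iota_uniq _ _) _ => j jN; rewrite mem_cat !mem_filter jN !andbT.
  have [t1|t1] := pselect (T1 j); first by rewrite (asboolT t1).
  have [t2|t2] := pselect (T2 j); first by rewrite (asboolT t2) orbT.
  by exfalso; apply: no; exists j; split=> //; move: jN; rewrite mem_iota add0n.
rewrite size_iota size_cat; lia.
Qed.

Lemma finite_window V (o : nat -> int -> V) m n :
  finite_set [set v | exists i z, [/\ i < m, `|z|%N <= n & v = o i z]].
Proof.
have fz : finite_set [set z : int | `|z|%N <= n].
  apply: sub_finite_set (_ : _ `<=` (Posz @` `I_n.+1) `|` (Negz @` `I_n.+1)) _.
    by move=> [p|p] /= h; [left|right]; exists p => //=; lia.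
  by rewrite finite_setU; split; apply/finite_image/finite_II.
apply: sub_finite_set (finite_image2 o (finite_II m) fz).
by move=> v [i [z [? ? ->]]]; exists i => //; exists z.
Qed.

(** * Negligible sets and packings that cannot become infinite *)

Section Bounds.
Variable V : Type.
Implicit Types (E L : V -> V -> Prop) (S U W X Z : set V).

(** With rays in U and anti-rays in the disjoint set W, the two kinds can be rerouted independently
    without ever meeting. Large families of crossing members could therefore be extended one by one
    to an infinite packing. *)
Lemma most_crossing E L U W : (forall x, U x -> ~ W x) -> ~ infinite_packing E L ->
  most E L (fun d => ~ ((forall p, U (d (Posz p))) /\ (forall p, W (d (Negz p))))).
Proof.
move=> dUW ninf; apply: contrapT => /not_most many; apply: ninf.
pose crosses (d : int -> V) := (forall p, U (d (Posz p))) /\ (forall p, W (d (Negz p))).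
have {}many m : exists o, packing E L `I_m o /\ forall i, i < m -> crosses (o i).
  by have [o [pk h]] := many m; exists o; split=> // i /h /contrapT.
pose Inv n o := packing E L `I_n o /\ forall i, i < n -> crosses (o i).
apply: (limit_packing (Inv := Inv)); [exact: many|by move=> ? ? []|].
move=> n o [pk cr].
(* The window goes up to [n.+1] because [Negz n] has absolute value [n.+1]. *)
pose X := [set v | exists i z, [/\ i < n.+1, `|z|%N <= n.+1 & v = o i z]].
have fX : finite_set X by exact: finite_window.
have [m Hm] := select_most (n + n.+1) (most_avoids_finite E L fX).
have [o1 [pk1 cr1]] := many m; have [h [hm hinj hav]] := Hm _ pk1.
pose t j := o1 (h j).
have tcr j : j < n + n.+1 -> crosses (t j) by move=> /hm /cr1.
have pkt : packing E L `I_(n + n.+1) t by exact: packing_sub pk1.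
have tav j z i y : j < n + n.+1 -> i < n -> `|y|%N <= n.+1 -> o i y <> t j z.
  move=> /hav tX i_n yn e; apply: (tX z); exists i, y; split=> //; exact: leqW.
have [r a d l] := pk; have [tr ta td tl] := pkt.
have [|||g1 [g1r g1eq g1in g1t]] :=
  @reroute _ E n (n + n.+1) (fun i p => o i (Posz p)) (fun j z => t j (Posz `|z|%N))
    (fun z => (0 <= z)%R) _ r.
- by move=> y z; lia.
- move=> j z jN z0; have -> : `|(z + 1)%R|%N = (`|z|%N).+1 by lia.
  exact: tr.1.
- move=> j k y z jN kN y0 z0 e; have [-> yz] := packing_inj pkt jN kN e; split=> //; lia.
have [|||g2 [g2r g2eq g2in g2t]] :=
  @reroute _ (flip E) n (n + n.+1) (fun i p => o i (Negz p)) (fun j z => t j (Negz `|z|%N))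
    (fun z => (0 <= z)%R) _ a.
- by move=> y z; lia.
- move=> j z jN z0; have -> : `|(z + 1)%R|%N = (`|z|%N).+1 by lia.
  exact: ta.1.
- move=> j k y z jN kN y0 z0 e; have [-> yz] := packing_inj pkt jN kN e; split=> //; lia.
(* A candidate untouched by both reroutings becomes the new member. *)
have [j [jN nt1 nt2]] := untouched_index g1t g2t.
have g1U i p : i < n -> U (g1 i p).
  move=> i_n; have [[q ->]|[k [z [kN _ ->]]]] := g1in i p i_n.
    exact: (cr _ i_n).1.
  exact: (tcr _ kN).1.
have g2W i p : i < n -> W (g2 i p).
  move=> i_n; have [[q ->]|[k [z [kN _ ->]]]] := g2in i p i_n.
    exact: (cr _ i_n).2.
  exact: (tcr _ kN).2.
have g1o i p : i < n -> p <= n -> g1 i p = o i (Posz p).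
  by move=> i_n pn; apply: g1eq => // q k z qp kN _; apply: tav => //=; lia.
have g2o i p : i < n -> p <= n -> g2 i p = o i (Negz p).
  by move=> i_n pn; apply: g2eq => // q k z qp kN _; apply: tav => //=; lia.
exists (mix (fun i => if i < n then g2 i else fun p => t j (Negz p))
            (fun i => if i < n then g1 i else fun p => t j (Posz p))).
have cr' : forall i, i < n.+1 -> crosses (mix
    (fun i => if i < n then g2 i else fun p => t j (Negz p))
    (fun i => if i < n then g1 i else fun p => t j (Posz p)) i).
  move=> i _; rewrite /crosses /=; case: ltnP => i_n; last exact: tcr.
  by split=> p; [exact: g1U | exact: g2W].
split; last first.
  by move=> i [p|p] i_n pn /=; rewrite i_n; [apply: g1o|apply: g2o] => //; lia.
split=> //; split.
- apply: rays_extend => //; first by move=> p; exact: tr.1.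
    by move=> p q /(tr.2 _ _ _ _ jN jN) [].
  by move=> i p q i_n e; apply: nt1; exists i, p, (Posz q).
- apply: rays_extend => //; first by move=> p; exact: ta.1.
    by move=> p q /(ta.2 _ _ _ _ jN jN) [].
  by move=> i p q i_n e; apply: nt2; exists i, p, (Posz q).
- move=> i k p q iN kN e; have [Ui _] := cr' i iN; have [_ Wk] := cr' k kN.
  by apply: (dUW _ (Ui p)); rewrite e; exact: Wk.
(* First vertices are kept, so the link between anti-ray and ray survives. *)
- by move=> i iN /=; case: ifP => i_n; rewrite ?g1o ?g2o //; [exact: l|exact: tl].
Qed.

Definition negligible E L Z := most E L (avoids Z).

Lemma negligible_sub E L Z Z' : Z `<=` Z' -> negligible E L Z' -> negligible E L Z.
Proof. by move=> ZZ; apply: most_mono => d dZ z /ZZ /dZ. Qed.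

Lemma negligible_setU E L Z Z' : negligible E L Z -> negligible E L Z' ->
  negligible E L (Z `|` Z').
Proof. by move=> h h'; apply: most_mono (most_and h h') => d [d1 d2] z [/d1|/d2]. Qed.

Lemma negligible_finite E L X : finite_set X -> negligible E L X.
Proof. exact: most_avoids_finite. Qed.

Lemma negligible_bigcup E L n (Z : nat -> set V) : (forall i, i < n -> negligible E L (Z i)) ->
  negligible E L [set v | exists2 i, i < n & Z i v].
Proof.
elim: n => [|n IH] h.
  by apply: negligible_sub (negligible_finite E L (finite_set0 V)) => v [].
apply: negligible_sub (negligible_setU (IH (fun i i_n => h i (leqW i_n))) (h n (ltnSn n))).
move=> v [i]; rewrite ltnS leq_eqVlt => /orP[/eqP ->|i_n] Zv; first by right.
by left; exists i.
Qed.

(* Double rays whose rays are negligible can be added one after the other, as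
   the next ones avoid these rays and only the anti-rays have to be rerouted. *)
Lemma most_ray_heavy E : ~ infinite_packing E E ->
  most E E (fun d => ~ negligible E E (range (fun p : nat => d (Posz p)))).
Proof.
move=> ninf; apply: contrapT => /not_most many; apply: ninf.
pose light (d : int -> V) := negligible E E (range (fun p : nat => d (Posz p))).
have {}many m : exists o, packing E E `I_m o /\ forall i, i < m -> light (o i).
  by have [o [pk h]] := many m; exists o; split=> // i /h /contrapT.
pose Inv n o := packing E E `I_n o /\ forall i, i < n -> light (o i).
apply: (limit_packing (Inv := Inv)); [exact: many|by move=> ? ? []|].
move=> n o [pk lt].
pose X := [set v | exists i z, [/\ i < n.+1, `|z|%N <= n.+1 & v = o i z]] `|`
  [set v | exists2 i, i < n & range (fun p : nat => o i (Posz p)) v].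
have nX : negligible E E X.
  apply: negligible_setU (negligible_bigcup lt).
  exact/negligible_finite/finite_window.
have [m Hm] := select_most (n + n.+1) nX.
have [o1 [pk1 lt1]] := many m; have [h [hm hinj hav]] := Hm _ pk1.
pose t j := o1 (h j).
have pkt : packing E E `I_(n + n.+1) t by exact: packing_sub pk1.
have [r a d l] := pk; have [tr ta td tl] := pkt.
have tpos i p j z : i < n -> j < n + n.+1 -> o i (Posz p) <> t j z.
  by move=> i_n jN e; apply: (hav j jN z); right; exists i => //; exists p.
(* An old anti-ray may meet either half of a new double ray, so the targets are entire double rays,
   reversed by [- z]. *)
have [|||g [gr geq gin gt]] :=
  @reroute _ (flip E) n (n + n.+1) (fun i p => o i (Negz p)) (fun j z => t j (- z)%R)
    (fun z => True) _ a.
- by [].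
- move=> j z jN _; rewrite /flip; have := packing_step (- (z + 1))%R pkt jN.
  by have -> : (- (z + 1) + 1 = - z)%R by lia.
- move=> j k y z jN kN _ _ e; have [-> yz] := packing_inj pkt jN kN e; split=> //; lia.
have [j [jN nt _]] := untouched_index gt gt.
have go i p : i < n -> p <= n -> g i p = o i (Negz p).
  move=> i_n pn; apply: geq => // q k z qp kN _ e; apply: (hav k kN (- z)%R).
  by left; exists i, (Negz q); split=> //=; lia.
have gt' i p z : i < n -> g i p <> t j z.
  by move=> i_n e; apply: nt; exists i, p, (- z)%R; rewrite opprK.
exists (mix (fun i => if i < n then g i else fun p => t j (Negz p))
            (fun i => if i < n then fun p => o i (Posz p) else fun p => t j (Posz p))).
split; last first.
  by move=> i [p|p] i_n pn /=; rewrite i_n //; apply: go => //; lia.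
split; last first.
  move=> i iN; rewrite /light /=; case: ltnP => i_n; first exact: lt.
  by apply: lt1; apply: hm.
split.
- apply: rays_extend => //; first by move=> p; exact: tr.1.
    by move=> p q /(tr.2 _ _ _ _ jN jN) [].
  by move=> i p q i_n; exact: tpos.
- apply: rays_extend => //; first by move=> p; exact: ta.1.
    by move=> p q /(ta.2 _ _ _ _ jN jN) [].
  by move=> i p q i_n; exact: gt'.
- move=> i k p q iN kN /=; case: ltnP => i_n; case: ltnP => k_n.
  + have [[q' ->]|[k' [z [kN' _ ->]]]] := gin k q k_n; first exact: d.
    exact: tpos.
  + exact: tpos.
  + by move=> /esym; exact: gt'.
  + exact: td.
- by move=> i iN /=; case: ifP => i_n; rewrite ?go //; [exact: l|exact: tl].
Qed.

Lemma most_flip E P : most (flip E) (flip E) P -> most E E (fun d => P (fun z => d (- 1 - z)%R)).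
Proof. by move=> [m Hm]; exists m => o /packing_flip /Hm. Qed.

Lemma infinite_packing_flip E : infinite_packing (flip E) (flip E) -> infinite_packing E E.
Proof. by move=> [o /packing_flip pk]; exists (fun i z => o i (- 1 - z)%R). Qed.

Lemma negligible_flip E Z : negligible E E Z -> negligible (flip E) (flip E) Z.
Proof.
move=> h; apply: most_mono (most_flip (E := flip E) h) => d dZ z.
by have := dZ (- 1 - z)%R; have -> : (- 1 - (- 1 - z) = z)%R by lia.
Qed.

Lemma most_antiray_heavy E : ~ infinite_packing E E ->
  most E E (fun d => ~ negligible E E (range (fun p : nat => d (Negz p)))).
Proof.
move=> ninf; have /most_ray_heavy : ~ infinite_packing (flip E) (flip E).
  by move/infinite_packing_flip.
move/most_flip; apply: most_mono => d h /negligible_flip; apply: contra_not h.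
apply: negligible_sub => _ [p _ <-]; exists p => //.
by congr (d _); lia.
Qed.

End Bounds.

(** * Linking anti-rays to rays *)

Section Walks.
Variable V : Type.
Implicit Types (E L : V -> V -> Prop) (S U W X Y Z A B : set V).

(** Vertices may repeat, which makes concatenation easy; [minimal_walk] recovers paths. *)
Definition walk E Y n (f : nat -> V) : Prop :=
  (forall p, p < n -> E (f p) (f p.+1)) /\ (forall p, p <= n -> Y (f p)).

Definition linked E Y A B : Prop := exists n f, [/\ walk E Y n f, A (f 0) & B (f n)].

Lemma linked_sub E Y Y' A A' B B' : Y `<=` Y' -> A `<=` A' -> B `<=` B' ->
  linked E Y A B -> linked E Y' A' B'.
Proof.
move=> YY AA BB [n [f [[fE fY] /AA ? /BB ?]]]; exists n, f; split=> //.
by split=> // p /fY /YY.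
Qed.

Lemma linked_trans E Y A B x : linked E Y A [set x] -> linked E Y [set x] B -> linked E Y A B.
Proof.
move=> [n [f [[fE fY] Af fn]]] [m [g [[gE gY] g0 Bg]]].
rewrite /= in fn g0.
exists (n + m), (fun p => if p <= n then f p else g (p - n)); split => //; last first.
  case: ifP => // h; last by rewrite addKn.
  have m0 : m = 0 by lia.
  by move: Bg; rewrite m0 addn0 g0 fn.
split=> p pnm; last by case: ifP => h; [exact: fY | apply: gY; lia].
case: (ltngtP p n) => pn.
- exact: fE.
- rewrite subSn 1?ltnW //; apply: gE; lia.
- by rewrite pn subSnn fn -g0; apply: gE; lia.
Qed.

Lemma linked_refl E Y x : Y x -> linked E Y [set x] [set x].
Proof. by move=> Yx; exists 0, (fun=> x); split. Qed.

Lemma linked_step E Y x y : Y x -> Y y -> E x y -> linked E Y [set x] [set y].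
Proof.
move=> Yx Yy xy; exists 1, (fun p => if p is 0 then x else y); split=> //.
by split=> [[|p]|[|p]].
Qed.

(** A shortest walk works: a repeated vertex, a late visit to A or an early visit to B would allow a
    shortcut. *)
Lemma minimal_walk E Y A B : linked E Y A B -> exists n f,
  [/\ walk E Y n f, A (f 0) /\ B (f n),
      forall p q, p <= n -> q <= n -> f p = f q -> p = q,
      forall p, p <= n -> A (f p) -> p = 0
    & forall p, p <= n -> B (f p) -> p = n].
Proof.
move=> lk; pose P n := `[< exists f, [/\ walk E Y n f, A (f 0) & B (f n)] >].
have exP : exists n, P n by have [n [f h]] := lk; exists n; apply/asboolP; exists f.
case: (ex_minnP exP) => n /asboolP [f [[fE fY] fA fB]] nmin.
have {}nmin m g : walk E Y m g -> A (g 0) -> B (g m) -> n <= m.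
  by move=> *; apply: nmin; apply/asboolP; exists g.
exists n, f; split=> //.
- suff lt p q : p < q -> q <= n -> f p <> f q.
    move=> p q pn qn e; case: (ltngtP p q) => // pq; first by case: (lt p q pq qn).
    by case: (lt q p pq pn).
  move=> pq qn e.
  (* The closed part between positions p and q is cut out. *)
  pose g k := if k <= p then f k else f (k + (q - p)).
  have : n <= n - (q - p); last by lia.
  apply: (nmin _ g); rewrite /g //.
    split=> k kn; last by case: ifP => _; apply: fY; lia.
    case: (ltngtP k p) => kp.
    - apply: fE; lia.
    - by rewrite addSn; apply: fE; lia.
    - have -> : k.+1 + (q - p) = q.+1 by lia.
      by rewrite kp e; apply: fE; lia.
  case: ifP => h; last by rewrite subnK //; lia.
  have qn' : q = n by lia.
  have -> : n - (q - p) = p by lia.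
  by rewrite e qn'.
- move=> p pn Ap; have : n <= n - p; last by lia.
  apply: (nmin _ (fun k => f (p + k))); rewrite ?addn0 ?subnKC //.
  split=> k kn; last by apply: fY; lia.
  by rewrite addnS; apply: fE; lia.
- move=> p pn Bp; have : n <= p; last by lia.
  apply: (nmin _ f) => //.
  by split=> k kp; [apply: fE | apply: fY]; lia.
Qed.

Lemma finite_walks (P : nat -> nat -> V) (len : nat -> nat) m :
  finite_set [set v | exists l p, [/\ l < m, p <= len l & v = P l p]].
Proof.
pose M := \max_(l < m) len l.
apply: sub_finite_set (finite_image2 P (finite_II m) (finite_II M.+1)).
move=> v [l [p [lm pl ->]]]; exists l => //; exists p => //=.
rewrite ltnS; apply: leq_trans pl _; exact: (leq_bigmax (Ordinal lm)).
Qed.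

Lemma free_index k m (a : nat -> nat) : m < k -> exists2 i, i < k & forall l, l < m -> a l <> i.
Proof.
move=> mk; apply: contrapT => no.
have : size (iota 0 k) <= size (map a (iota 0 m)).
  apply: uniq_leq_size (iota_uniq _ _) _ => i; rewrite mem_iota add0n => /andP[_ ik].
  apply: contrapT => ni; apply: no; exists i => // l lm e; apply: ni.
  by rewrite -e map_f // mem_iota.
by rewrite size_map !size_iota; lia.
Qed.

Definition is_ray E (r : nat -> V) : Prop := (forall p, E (r p) (r p.+1)) /\ injective r.

Lemma rays_is_ray E (K : set nat) f i : rays E K f -> K i -> is_ray E (f i).
Proof. by move=> [st inj] Ki; split=> [p|p q /inj []//]; exact: st. Qed.

Definition outside X (r : nat -> V) : Prop := forall p, ~ X (r p).

Definition tightly_linked E : Prop := forall X, finite_set X -> forall a r,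
  is_ray (flip E) a -> is_ray E r -> outside X a -> outside X r ->
  linked E (~` X) (range a) (range r).

(** * Double rays in tightly linked digraphs *)

Section Tight.
Variables (E L : V -> V -> Prop).
Hypothesis tight : tightly_linked E.

Lemma disjoint_links k o m : packing E L `I_k o -> m <= k ->
  exists (a b len : nat -> nat) (P : nat -> nat -> V),
  [/\ forall l, l < m -> a l < k /\ b l < k,
      (forall l l', l < m -> l' < m -> a l = a l' -> l = l') /\
      (forall l l', l < m -> l' < m -> b l = b l' -> l = l'),
      forall l, l < m -> [/\ walk E setT (len l) (P l),
        exists c, P l 0 = o (a l) (Negz c) & exists c, P l (len l) = o (b l) (Posz c)],
      forall l l' p p', l < m -> l' < m -> p <= len l -> p' <= len l' ->
        P l p = P l' p' -> l = l' /\ p = p'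
    & (forall i l p c, i < k -> (forall l, l < m -> a l <> i) -> l < m -> p <= len l ->
        P l p <> o i (Negz c)) /\
      (forall i l p c, i < k -> (forall l, l < m -> b l <> i) -> l < m -> p <= len l ->
        P l p <> o i (Posz c))].
Proof.
move=> pk; have [rr ra rd rl] := pk.
elim: m => [_|m IH mk].
  exists id, id, id, (fun _ _ => o 0 0%R).
  by do ![split=> //]; move=> *.
have [a [b [len [P [abk [ainj binj] PW Pinj [fa fb]]]]]] := IH (ltnW mk).
pose X := [set v | exists l p, [/\ l < m, p <= len l & v = P l p]].
pose A := [set v | exists i c, [/\ i < k, (forall l, l < m -> a l <> i) & v = o i (Negz c)]].
pose B := [set v | exists i c, [/\ i < k, (forall l, l < m -> b l <> i) & v = o i (Posz c)]].
have lk : linked E (~` X) A B.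
  have [i ik fi] := free_index a mk; have [j jk fj] := free_index b mk.
  apply: linked_sub (tight (finite_walks P len m) (rays_is_ray ra ik) (rays_is_ray rr jk) _ _).
  - by [].
  - by move=> _ [c _ <-]; exists i, c.
  - by move=> _ [c _ <-]; exists j, c.
  - by move=> c [l [p [lm pl /esym]]]; apply: fa.
  - by move=> c [l [p [lm pl /esym]]]; apply: fb.
have [n [f [[fE fX] [[i [c [ik fi f0]]] [j [c' [jk fj fn]]]] finj fA fB]]] := minimal_walk lk.
have fresh l p q : l < m -> p <= len l -> q <= n -> P l p <> f q.
  by move=> lm pl qn e; apply: (fX q qn); exists l, p.
pose ext T (g : nat -> T) x := fun l => if l < m then g l else x.
exists (ext _ a i), (ext _ b j), (ext _ len n), (ext _ P f); rewrite /ext.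
have notm l : l < m.+1 -> ~~ (l < m) -> l = m by lia.
split.
- by move=> l lm; case: ifP => // /abk.
- split=> l l' lm lm'; case: ifP => h; case: ifP => h'; try lia.
  + exact: ainj.
  + by move/fi; case.
  + by move/esym/fi; case.
  + exact: binj.
  + by move/fj; case.
  + by move/esym/fj; case.
- move=> l lm; case: ifP => h; first exact: PW.
  by split; [split|exists c|exists c'].
- move=> l l' p p' lm lm'; case: ifP => h; case: ifP => h' pl pl'.
  + exact: Pinj.
  + by move/fresh; case.
  + by move/esym/fresh; case.
  + move/finj => -> //; split=> //; lia.
- split=> t l p d tk free lm.
  + have ft : forall l, l < m -> a l <> t.
      by move=> l' l'm e; apply: (free l'); rewrite ?l'm // leqW.
    have ti : i <> t by move: (free m); rewrite ltnn => /(_ (ltnSn m)).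
    case: ifP => h pl; first exact: fa.
    move=> e; have p0 : p = 0 by apply: fA => //; exists t, d.
    subst p; have : o i (Negz c) = o t (Negz d) by rewrite -f0 -e.
    by move=> /(packing_inj pk ik tk) [].
  + have ft : forall l, l < m -> b l <> t.
      by move=> l' l'm e; apply: (free l'); rewrite ?l'm // leqW.
    have ti : j <> t by move: (free m); rewrite ltnn => /(_ (ltnSn m)).
    case: ifP => h pl; first exact: fb.
    move=> e; have p0 : p = n by apply: fB => //; exists t, d.
    subst p; have : o j (Posz c') = o t (Posz d) by rewrite -fn -e.
    by move=> /(packing_inj pk jk tk) [].
Qed.

(** Take 4n disjoint links. Rerouting the reversed links into the anti-rays keeps 2n of them, and
    rerouting the surviving link segments forwards into the rays keeps n, each with an anti-ray
    behind it. *)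
Lemma tight_double_rays : unbounded_packing E L -> unbounded_packing E E.
Proof.
move=> ub n; pose k := n.*2.*2; have [o pk] := ub k.
have [r a d _] := pk.
have [al [be [len [P [abk [ainj binj] PW Pinj _]]]]] := disjoint_links pk (leqnn k).
have raysA : rays (flip E) `I_k (fun l p => o (al l) (Negz p)).
  apply: (rays_sub (f := fun l p => o l (Negz p)) _ _ a) => [l /abk [] //|]; exact: ainj.
have [||l lk|a1 [s1 [g1 [a1inj a1s1 g1r g1f g1t]]]] :=
  @reroute_half V (flip E) n.*2 (fun l p => P l (len l - p)) len _ _ _ raysA.
- move=> l p lk pl; have [[PE _] _ _] := PW l lk.
  rewrite /flip; have -> : len l - p = (len l - p.+1).+1 by lia.
  by apply: PE; lia.
- move=> l l' p p' lk lk' pl pl' e.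
  have [ll pp] := Pinj _ _ _ _ lk lk' (leq_subr _ _) (leq_subr _ _) e.
  by subst l'; split=> //; lia.
- by have [_ [c Pc] _] := PW l lk; exists c; rewrite subnn.
have raysR : rays E `I_(n.*2) (fun l p => o (be (a1 l)) (Posz p)).
  apply: (rays_sub (h := fun l => be (a1 l)) (f := fun l p => o l (Posz p)) _ _ r)
    => [l|l l' lk lk'].
    by move=> /a1s1 [/abk []].
  by have [? _] := a1s1 _ lk; have [? _] := a1s1 _ lk'; move/binj => /(_ _ _)/a1inj; apply.
have [||l lk|a2 [s2 [g2 [a2inj a2s2 g2r g2f g2t]]]] :=
  @reroute_half V E n (fun l p => g1 l (s1 l - p)) s1 _ _ _ raysR.
- move=> l p lk pl; have -> : s1 l - p = (s1 l - p.+1).+1 by lia.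
  exact: g1r.1.
- move=> l l' p p' lk lk' pl pl' e; have [ll pp] := g1r.2 _ _ _ _ lk lk' e.
  by subst l'; split=> //; lia.
- have [ak _] := a1s1 l lk; have [_ _ [c Pc]] := PW _ ak; exists c.
  by rewrite subnn g1f // subn0.
(* The anti-ray begins one vertex past the stop [s1], as the vertex at the stop is the first one of
   [g2]. *)
exists (mix (fun l p => g1 (a2 l) (s1 (a2 l) + p.+1)) g2); split=> //.
- split=> [l p ln|l l' p q ln ln' /= e].
    rewrite /flip /=; have := g1r.1 (a2 l) (s1 (a2 l) + p.+1) (a2s2 _ ln).1.
    by rewrite /flip -addnS.
  have [/a2inj ll pq] := g1r.2 _ _ _ _ (a2s2 _ ln).1 (a2s2 _ ln').1 e.
  by have {}ll := ll ln ln'; subst l'; split=> //; lia.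
- move=> l l' p q ln ln' /= e.
  (* Up to [s2] both vertices lie on [g1], on different sides of the stop; afterwards one lies on an
     original ray and the other on an original anti-ray. *)
  have [ps|sp] := leqP p (s2 l).
    rewrite g2f // in e.
    have [ll pq] := g1r.2 _ _ _ _ (a2s2 _ ln).1 (a2s2 _ ln').1 e.
    by rewrite -ll in pq; lia.
  have [j [c [jk ej]]] := g2t l p ln (ltnW sp).
  have [j' [c' [jk' ej']]] := g1t (a2 l') (s1 (a2 l') + q.+1) (a2s2 _ ln').1 (leq_addr _ _).
  apply: (d (be (a1 j)) (al j') c c'); last by rewrite -ej -ej'.
    by have [/abk []] := a1s1 j jk.
  by have [] := abk _ jk'.
- move=> l ln /=; rewrite g2f // subn0 addn1.
  exact: (g1r.1 (a2 l) (s1 (a2 l)) (a2s2 _ ln).1).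
Qed.
End Tight.
End Walks.

(** * Rays and anti-rays without infinite packings *)

Section RayAntiray.
Variable V : Type.
Implicit Types (E L : V -> V -> Prop) (S U W X Y Z A B : set V).

Definition restrict E S : V -> V -> Prop := fun u v => [/\ E u v, S u & S v].
Definition unrelated : V -> V -> Prop := fun _ _ => True.

Lemma eventually_avoids X (r : nat -> V) : finite_set X -> injective r ->
  exists p0, forall p, p0 <= p -> ~ X (r p).
Proof.
move=> fX rinj; move: X fX; apply: finite_set_elim => [|x X [p0 h]]; first by exists 0 => p _ [].
have [[q rq]|no] := pselect (exists q, r q = x).
  exists (maxn p0 q.+1) => p; rewrite geq_max => /andP[? qp] [e|]; last exact: h.
  by move: qp; rewrite (rinj p q) ?ltnn // rq.
by exists p0 => p pp [e|]; [apply: no; exists p | exact: h].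
Qed.

Lemma eventually_in Z Z' (s : nat -> V) : (forall p, Z (s p) \/ Z' (s p)) ->
  (forall p, Z (s p) -> Z (s p.+1)) ->
  (exists p0, forall p, p0 <= p -> Z (s p)) \/ (forall p, Z' (s p)).
Proof.
move=> zz st; have [[p0 Z0]|no] := pselect (exists p, Z (s p)).
  left; exists p0; elim=> [|p IH]; first by rewrite leqn0 => /eqP <-.
  by rewrite leq_eqVlt => /orP[/eqP <- //|/IH /st].
by right=> p; have [Zp|//] := zz p; case: no; exists p.
Qed.

Lemma packing_tails E K o (h : nat -> nat) : packing E unrelated K o ->
  packing E unrelated K (mix (fun i p => o i (Negz (h i + p))) (fun i p => o i (Posz (h i + p)))).
Proof.
move=> [[rs ri] [as_ ai] d _]; split=> //.
- split=> [i p Ki|i j p q Ki Kj /= /ri [] // ij ?]; first by rewrite /= addnS; exact: rs.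
  by subst j; split=> //; lia.
- split=> [i p Ki|i j p q Ki Kj /= /ai [] // ij ?]; first by rewrite /flip /= addnS; exact: as_.
  by subst j; split=> //; lia.
- by move=> i j p q Ki Kj; exact: d.
Qed.

(** Passing to tails preserves packings, because [unrelated] demands no link between anti-ray and
    ray. *)
Lemma most_tails E Z Z' :
  most E unrelated (fun d => ~ ((forall p, Z (d (Posz p))) /\ (forall p, Z' (d (Negz p))))) ->
  most E unrelated (fun d => ~ exists p0, forall p, p0 <= p -> Z (d (Posz p)) /\ Z' (d (Negz p))).
Proof.
move=> [m Hm]; exists m => o pk; apply: contrapT => no.
have h i : exists p0, i < m -> forall p, p0 <= p -> Z (o i (Posz p)) /\ Z' (o i (Negz p)).
  have [im|] := ltnP i m; last by exists 0.
  have [p0 hp] : exists p0, forall p, p0 <= p -> Z (o i (Posz p)) /\ Z' (o i (Negz p)).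
    by apply: contrapT => ni; apply: no; exists i.
  by exists p0.
have [f Hf] := choice h.
have [i im] := Hm _ (packing_tails f pk); apply; rewrite /=.
by split=> p; have [] := Hf i im (f i + p) (leq_addr _ _).
Qed.

Lemma most_not_inside E L U : ~ unbounded_packing (restrict E U) L ->
  most E L (fun d => ~ ((forall p, U (d (Posz p))) /\ (forall p, U (d (Negz p))))).
Proof.
move=> nub; apply: contrapT => /not_most many; apply: nub => n.
have [o [[[rs ri] [as_ ai] d l] h]] := many n.
have {}h i : i < n -> (forall p, U (o i (Posz p))) /\ (forall p, U (o i (Negz p))).
  by move=> /h /contrapT.
exists o; split=> //; split=> // i p i_n; have [? ?] := h i i_n; split=> //.
  exact: rs.
exact: as_.
Qed.

Definition reachable E X A : set V := [set v | linked E (~` X) A [set v]].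

Lemma reachable_step E X A u v : reachable E X A u -> E u v -> ~ X v -> reachable E X A v.
Proof.
move=> Ru uv nXv; apply: linked_trans (Ru) _; apply: linked_step => //.
by case: Ru => n [f [[_ fX] _ <-]]; exact: fX.
Qed.

Lemma reachable_self E X A v : A v -> ~ X v -> reachable E X A v.
Proof. by move=> Av nX; exists 0, (fun=> v); split. Qed.

(** A finite X separates some anti-ray from some ray; U is what the anti-ray reaches outside X. Most
    members avoid X and have each tail in U or W. Mixed tails are rare by [most_crossing], and if
    neither side had large packings, so would be tails on a common side. *)
Lemma not_tight_split E : unbounded_packing E unrelated ->
  ~ infinite_packing E unrelated -> ~ tightly_linked E ->
  exists X U W a r,
    [/\ finite_set X, forall v, [\/ X v, U v | W v],
        (forall v, U v -> ~ W v) /\ (forall u v, E u v -> U u -> ~ W v),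
        [/\ is_ray (flip E) a, forall p, U (a p), is_ray E r & forall p, W (r p)]
      & unbounded_packing (restrict E U) unrelated \/
        unbounded_packing (restrict E W) unrelated].
Proof.
move=> ub ninf ntight.
have [X [fX [a [r [ra [rr [aX [rX nl]]]]]]]] : exists X, finite_set X /\ exists a r,
    is_ray (flip E) a /\ is_ray E r /\ outside X a /\ outside X r /\
    ~ linked E (~` X) (range a) (range r).
  apply: contrapT => no; apply: ntight => X fX a r ra rr aX rX.
  by apply: contrapT => nl; apply: no; exists X; split=> //; exists a, r.
pose U := reachable E X (range a); pose W := ~` X `\` U.
have UW v : U v -> ~ W v by move=> Uv [].
have arcUW u v : E u v -> U u -> ~ W v.
  by move=> uv Uu [nX nU]; apply: nU; exact: reachable_step uv nX.
have part v : ~ X v -> U v \/ W v.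
  by move=> nX; have [?|?] := pselect (U v); [left|right].
exists X, U, W, a, r; split=> //.
- move=> v; have [?|/part []] := pselect (X v);
    [exact: Or31 | exact: Or32 | exact: Or33].
- split=> // p; first by apply: reachable_self (aX p); exists p.
  split; first exact: rX.
  move=> [n [f [fw f0 fn]]]; apply: nl; exists n, f; split=> //.
  by rewrite fn; exists p.
apply: contrapT => /not_orP [nU nW].
have mUU := most_tails (most_not_inside nU).
have mWW := most_tails (most_not_inside nW).
have mUW := most_tails (most_crossing (L := unrelated) UW ninf).
have mWU : most E unrelated (fun d =>
    ~ exists p0, forall p, p0 <= p -> W (d (Posz p)) /\ U (d (Negz p))).
  by apply/most_tails/most_crossing => // v Wv /UW.
have [m Hm] := most_and (most_avoids_finite E unrelated fX)
  (most_and (most_and mUU mWW) (most_and mUW mWU)).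
have [o pk] := ub m; have [i im [oX [[hUU hWW] [hUW hWU]]]] := Hm o pk.
have [[rs _] [as_ _] _ _] := pk.
(* No arc leads from U to W, so a ray cannot leave U and, traversed backwards, an anti-ray cannot
   leave W. *)
have side_r : exists Z, (Z = U \/ Z = W) /\ exists p0, forall p, p0 <= p -> Z (o i (Posz p)).
  have [|p Up|h|h] := @eventually_in U W (fun p => o i (Posz p)).
  - by move=> p; apply/part/oX.
  - by apply: reachable_step Up _ (oX _); exact: rs.
  - by exists U; split; [left|].
  - by exists W; split; [right|exists 0].
have side_a : exists Z, (Z = U \/ Z = W) /\ exists p0, forall p, p0 <= p -> Z (o i (Negz p)).
  have [|p Wp|h|h] := @eventually_in W U (fun p => o i (Negz p)).
  - by move=> p; rewrite or_comm; apply/part/oX.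
  - have [Up|//] := part _ (oX (Negz p.+1)).
    by case: (arcUW _ _ (as_ i p im) Up).
  - by exists W; split; [right|].
  - by exists U; split; [left|exists 0].
have [Z [ZE [p0 hp]]] := side_r; have [Z' [Z'E [q0 hq]]] := side_a.
have both : exists p0, forall p, p0 <= p -> Z (o i (Posz p)) /\ Z' (o i (Negz p)).
  by exists (maxn p0 q0) => p; rewrite geq_max => /andP[? ?]; split; [exact: hp|exact: hq].
by case: ZE both => ->; case: Z'E => ->.
Qed.

Lemma restrict_mono E S S' u v : S `<=` S' -> restrict E S u v -> restrict E S' u v.
Proof. by move=> SS [? /SS ? /SS ?]. Qed.

Lemma restrictI E S S' u v : restrict (restrict E S) S' u v -> restrict E (S `&` S') u v.
Proof. by move=> [[? ? ?] ? ?]. Qed.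

Lemma unbounded_mono E E' L L' : (forall u v, E u v -> E' u v) ->
  (forall u v, L u v -> L' u v) -> unbounded_packing E L -> unbounded_packing E' L'.
Proof. by move=> EE LL ub n; have [o pk] := ub n; exists o; exact: packing_mono pk. Qed.

Lemma infinite_mono E E' L L' : (forall u v, E u v -> E' u v) ->
  (forall u v, L u v -> L' u v) -> infinite_packing E L -> infinite_packing E' L'.
Proof. by move=> EE LL [o pk]; exists o; exact: packing_mono pk. Qed.

Lemma is_ray_mono E E' r : (forall u v, E u v -> E' u v) -> is_ray E r -> is_ray E' r.
Proof. by move=> EE [st inj]; split=> // p; exact/EE/st. Qed.

(** The members peeled off lie in the differences of consecutive sets of a decreasing sequence,
    which are disjoint. *)
Lemma descending_packing E L :
  (forall S, unbounded_packing (restrict E S) L -> exists S', [/\ S' `<=` S,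
     unbounded_packing (restrict E S') L
   & exists d, packing (restrict E (S `\` S')) L `I_1 (fun=> d)]) ->
  unbounded_packing E L -> infinite_packing E L.
Proof.
move=> h ub.
have [||u Hu] := @dependent_choice _ (fun _ S => unbounded_packing (restrict E S) L)
  (fun _ S S' => S' `<=` S /\ exists d, packing (restrict E (S `\` S')) L `I_1 (fun=> d)).
- by exists setT; apply: unbounded_mono ub.
- by move=> _ S /h [S' [? ? ?]]; exists S'.
have [d Hd] := choice (fun n => (Hu n).2.2).
have mono i j : i <= j -> u j `<=` u i.
  elim: j => [|j IH]; first by rewrite leqn0 => /eqP ->.
  by rewrite leq_eqVlt => /orP[/eqP ->//|/IH le]; exact: subset_trans (Hu j).2.1 le.
have din i z : (u i `\` u i.+1) (d i z).
  have [[rs _] [as_ _] _ _] := Hd i.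
  by case: z => p; [have [] := rs 0 p isT | have [] := as_ 0 p isT].
have lt i j y z : i < j -> d i y <> d j z.
  by move=> ij e; have [_] := din i y; apply; rewrite e; apply: (mono _ _ ij); case: (din j z).
exists d; apply: packingI => [i p _|i p _|i _|i j y z _ _ e].
- by have [[rs _] _ _ _] := Hd i; have [] := rs 0 p isT.
- by have [_ [as_ _] _ _] := Hd i; have [] := as_ 0 p isT.
- by have [_ _ _ l] := Hd i; exact: (l 0 isT).
- case: (ltngtP i j) => ij; [by case: (lt _ _ y z ij)|by case: (lt _ _ z y ij)|].
  subst j; split=> //.
  by have [] := packing_inj (Hd i) (isT : `I_1 0) (isT : `I_1 0) e.
Qed.

(* The rays are peeled off from the nested sets, which every anti-ray eventually
   enters, so that the anti-rays can still be rerouted afterwards. *)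
Lemma nested_packing E S0 : unbounded_packing (restrict E S0) unrelated ->
  (forall S a, S `<=` S0 -> unbounded_packing (restrict E S) unrelated ->
     ~ is_ray (flip (restrict E (S0 `\` S))) a) ->
  (forall S, S `<=` S0 -> unbounded_packing (restrict E S) unrelated ->
     exists S' X r, [/\ S' `<=` S, finite_set X,
       unbounded_packing (restrict E S') unrelated, is_ray (restrict E (S `\` S')) r
     & forall u v, E u v -> S' u -> S v -> ~ S' v -> X v]) ->
  infinite_packing E unrelated.
Proof.
move=> ub noa step.
pose Inv n o := [/\ packing E unrelated `I_n o, forall i p, i < n -> S0 (o i (Negz p)) &
  exists S, [/\ S `<=` S0, unbounded_packing (restrict E S) unrelated,
    forall a, is_ray (flip (restrict E S0)) a -> exists p0, forall p, p0 <= p -> S (a p)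
  & forall i p, i < n -> ~ S (o i (Posz p))]].
apply: (limit_packing (Inv := Inv)); last first.
- move=> n o [pk oS [S [SS0 ubS evS oSr]]].
  have [S' [X [r [S'S fX ubS' [rst_ rinj] arcs]]]] := step S SS0 ubS.
  (* Beyond X an anti-ray in S that is outside [S'] stays outside. A tail of this kind is excluded
     by [noa], so the anti-ray must be in [S'] from then on. *)
  have evS' a : is_ray (flip (restrict E S0)) a -> exists p0, forall p, p0 <= p -> S' (a p).
    move=> ra; have [p0 h0] := evS a ra; have [ast ainj] := ra.
    have [p1 h1] := eventually_avoids fX ainj.
    pose b p := a (p0 + p1 + p).
    have bS p : S (b p) by apply: h0; rewrite -addnA leq_addr.
    have [|p [_ nS']|[q hq]|hq] := @eventually_in (S `\` S') S' b.
    - by move=> p; have [?|?] := pselect (S' (b p)); [right|left].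
    - split=> // S'p; apply: (h1 (p0 + p1 + p)); first by rewrite (addnC p0) -addnA leq_addr.
      have [e _ _] := ast (p0 + p1 + p); apply: arcs e _ (bS p) nS'.
      by move: S'p; rewrite /b addnS.
    - case: (noa S' (fun p => b (q + p))) => //; first exact: subset_trans SS0.
      split=> [p|p p' /ainj]; last by lia.
      have [Eb S0b S0b'] := ast (p0 + p1 + (q + p)).
      rewrite /flip /b addnS addnS; split=> //.
        split=> //; have [] := hq (q + p).+1 => //; first by rewrite -addnS leq_addr.
        by rewrite /b addnS.
      by split=> //; have [] := hq (q + p) (leq_addr _ _).
    - by exists (p0 + p1) => p pp; have := hq (p - (p0 + p1)); rewrite /b subnKC.
  pose Y := [set v | exists i z, [/\ i < n.+1, `|z|%N <= n.+1 & v = o i z]].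
  have fY : finite_set Y by exact: finite_window.
  have [t [pkt tav]] := most_unbounded (n + n.+1) ubS
    (most_avoids_finite (restrict E S) unrelated fY).
  have [rr [ast ainj] d _] := pk; have [tr [tst tinj] td _] := pkt.
  have tS j p : j < n + n.+1 -> S (t j (Negz p)) by move=> jN; have [] := tst j p jN.
  have [||||g [[gst ginj] geq gin gt]] :=
    @reroute _ (flip (restrict E S0)) n (n + n.+1) (fun i p => o i (Negz p))
      (fun j z => t j (Negz `|z|%N)) (fun z => (0 <= z)%R).
  - by move=> y z; lia.
  - by split=> [i p i_n|//]; split; [exact: ast|exact: oS|exact: oS].
  - move=> j z jN z0; have -> : `|(z + 1)%R|%N = (`|z|%N).+1 by lia.
    by apply: restrict_mono SS0 _; exact: tst.
  - move=> j k y z jN kN y0 z0 /tinj [] // -> e; split=> //; lia.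
  have [j [jN nt _]] := untouched_index gt gt.
  have go i p : i < n -> p <= n -> g i p = o i (Negz p).
    move=> i_n pn; apply: geq => // q k z qp kN _ e; apply: (tav k kN (Negz `|z|%N)).
    by exists i, (Negz q); split=> //=; lia.
  pose a' i := if i < n then g i else fun p => t j (Negz p).
  have a'r : rays (flip (restrict E S0)) `I_n.+1 a'.
    apply: rays_extend => //.
    - by move=> p; apply: restrict_mono SS0 _; exact: tst.
    - by move=> p q /tinj [].
    - by move=> i p q i_n e; apply: nt; exists i, p, (Posz q).
  (* All anti-rays end up in [S'], which r avoids, so they meet r only finitely often and a tail of
     r is free of them. *)
  have [p0 hp0] : exists p0, forall i p q, i < n.+1 -> p0 <= p -> a' i q <> r p.
    have ev i : exists q0, i < n.+1 -> forall q, q0 <= q -> S' (a' i q).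
      have [iN|] := ltnP i n.+1; last by exists 0.
      by have [q0 h] := evS' _ (rays_is_ray a'r iN); exists q0.
    have [f Hf] := choice ev.
    have [p0 h0] := eventually_avoids (finite_walks a' f n.+1) rinj.
    exists p0 => i p q iN pp e; have [qf|fq] := leqP q (f i).
      by apply: (h0 p pp); exists i, q.
    have [_ [_ nS'] _] := rst_ p; apply: nS'; rewrite -e; apply: Hf => //; exact: ltnW.
  pose r' i := if i < n then fun p => o i (Posz p) else fun p => r (p0 + p).
  have a'S0 i p : i < n.+1 -> S0 (a' i p).
    by move=> iN; have [_ _] := a'r.1 i p iN.
  have r'S' i p : i < n.+1 -> ~ S' (r' i p).
    rewrite /r' => _; case: (ltnP i n) => i_n; first by move=> /S'S; exact: (oSr i p i_n).
    by have [_ []] := rst_ (p0 + p).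
  exists (mix a' r'); split; last first.
    by move=> i [p|p] i_n pn /=; rewrite /a' /r' i_n //; apply: go => //; lia.
  split=> //; last by exists S'; split=> //; exact: subset_trans SS0.
  split=> //.
  + apply: rays_extend rr _ _ _ => [p|p q /rinj|i p q i_n e].
    * by rewrite addnS; have [] := rst_ (p0 + p).
    * by lia.
    * by apply: (oSr i p i_n); rewrite e; have [_ []] := rst_ (p0 + q).
  + by apply: rays_mono a'r => // u v [].
  + move=> i k p q iN kN /=; rewrite /r'; case: ltnP => i_n; last first.
      by move=> e; apply: (hp0 k (p0 + p) q kN (leq_addr _ _)).
    rewrite /a'; case: ltnP => k_n.
      have [[q' ->]|[k' [z [kN' _ ->]]]] := gin k q k_n; first exact: d.
      by move=> e; apply: (oSr i p i_n); rewrite e; exact: tS.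
    by move=> e; apply: (oSr i p i_n); rewrite e; exact: tS.
- by move=> n o [].
- have [o pk] := ub 0; exists o; split=> //.
  exists S0; split=> // a [st _]; exists 0 => p _; by have [_ _ ?] := st p.
Qed.

Lemma packing_flip_unrelated E K o : packing E unrelated K o ->
  packing (flip E) unrelated K (mix (fun i p => o i (Posz p)) (fun i p => o i (Negz p))).
Proof. by move=> [r a d l]; split=> // i j p q Ki Kj /= /esym; exact: d. Qed.

Lemma unbounded_flip E : unbounded_packing E unrelated -> unbounded_packing (flip E) unrelated.
Proof.
move=> ub n; have [o /packing_flip_unrelated pk] := ub n.
by exists (mix (fun i p => o i (Posz p)) (fun i p => o i (Negz p))).
Qed.

(** Without large families of double rays every set with large packings splits. If some such set
    never leaves an anti-ray behind when shrunk, or never a ray, [nested_packing] applies, possibly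
    after reversal. Otherwise both kinds can be peeled off again and again, and [descending_packing]
    applies. *)
Lemma unbounded_rays_antirays_double_rays E :
  unbounded_packing E unrelated -> ~ infinite_packing E unrelated ->
  unbounded_packing E E.
Proof.
move=> ub ninf; apply: contrapT => ndr.
have split_ S : unbounded_packing (restrict E S) unrelated ->
  exists X U W a r, [/\ finite_set X, forall v, [\/ X v, U v | W v],
        (forall v, U v -> ~ W v) /\ (forall u v, restrict E S u v -> U u -> ~ W v),
        [/\ is_ray (flip (restrict E S)) a, forall p, U (a p),
            is_ray (restrict E S) r & forall p, W (r p)]
      & unbounded_packing (restrict (restrict E S) U) unrelated \/
        unbounded_packing (restrict (restrict E S) W) unrelated].
  move=> ubS; apply: not_tight_split => //.
    by apply: contra_not ninf; apply: infinite_mono => // u v [].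
  apply: contra_not ndr => tight.
  by apply: unbounded_mono (tight_double_rays tight ubS) => u v [].
have inside S S' : unbounded_packing (restrict (restrict E S) S') unrelated ->
    unbounded_packing (restrict E (S `&` S')) unrelated.
  by apply: unbounded_mono => // u v; exact: restrictI.
pose no_rays F S0 := forall S a, S `<=` S0 -> unbounded_packing (restrict F S) unrelated ->
     ~ is_ray (restrict F (S0 `\` S)) a.
have [S0 [ubS0 noS0]] : exists S0, unbounded_packing (restrict E S0) unrelated /\
    (no_rays (flip E) S0 \/ no_rays E S0).
  apply: contrapT => no; apply: ninf; apply: descending_packing ub => S ubS.
  have h F S1 : ~ no_rays F S1 -> exists S' a, [/\ S' `<=` S1,
      unbounded_packing (restrict F S') unrelated & is_ray (restrict F (S1 `\` S')) a].
    move=> nF; apply: contrapT => no'; apply: nF => S' a SS' ubS' ra.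
    by apply: no'; exists S', a.
  have unflip S1 : unbounded_packing (restrict (flip E) S1) unrelated ->
      unbounded_packing (restrict E S1) unrelated.
    by move/unbounded_flip; apply: unbounded_mono => // u v [].
  (* An anti-ray is peeled off first, then a ray from the set that remains. *)
  have [S1 [a [S1S /unflip ubS1 [ast ainj]]]] : exists S' a, [/\ S' `<=` S,
      unbounded_packing (restrict (flip E) S') unrelated
      & is_ray (restrict (flip E) (S `\` S')) a].
    by apply: h => nr; apply: no; exists S; split=> //; left.
  have [S2 [r [S2S ubS2 [rst_ rinj]]]] : exists S' a, [/\ S' `<=` S1,
      unbounded_packing (restrict E S') unrelated & is_ray (restrict E (S1 `\` S')) a].
    by apply: h => nr; apply: no; exists S1; split=> //; right.
  exists S2; split=> //; first exact: subset_trans S1S.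
  exists (mix (fun=> a) (fun=> r) 0); apply: packingI => //=.
  - move=> _ p _; have [e [x1 x2] [y1 y2]] := rst_ p.
    by split=> //; split=> //; exact: S1S.
  - move=> _ p _; have [e [x1 x2] [y1 y2]] := ast p.
    by split=> //; split=> // /S2S.
  - move=> [|//] [|//] [p|p] [q|q] _ _ /= e; split=> //.
    + by rewrite (rinj _ _ e).
    + by exfalso; have [_ [h1 _] _] := rst_ p; have [_ [_ h2] _] := ast q; rewrite -e in h2.
    + by exfalso; have [_ [h1 _] _] := rst_ q; have [_ [_ h2] _] := ast p; rewrite e in h2.
    + by rewrite (ainj _ _ e).
apply: ninf; case: noS0 => noS0.
  apply: (nested_packing ubS0) => [S a SS ubS ra|S SS0 ubS].
    apply: (noS0 S a SS); first by apply: unbounded_mono (unbounded_flip ubS) => // u v [].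
    by apply: is_ray_mono ra => u v [].
  have [X [U [W [a [r [fX part [UW arcs] [ra aU [rst_ rinj] rW] [/inside big|/inside big]]]]]]] :=
    split_ S ubS.
    exists (S `&` U), X, r; split=> //.
      split=> // p; have [e h1 h2] := rst_ p.
      by split=> //; split=> // -[_ Ux]; apply: (UW _ Ux); exact: rW.
    move=> u v e [Su Uu] Sv nS'; have [//|Uv|Wv] := part v; first by case: nS'.
    by case: (arcs u v).
  (* Were W the large side, the anti-ray a, which lies in U, would be left behind in S0. *)
  case: (noS0 (S `&` W) a) => //.
    - by move=> v [/SS0].
    - by apply: unbounded_mono (unbounded_flip big) => // u v [].
  case: ra => ast ainj; split=> // p; have [e h1 h2] := ast p.
  by split=> //; (split; [exact: SS0|move=> [_]; exact: UW]).
(* The other case is handled in the reversed digraph, where U and W exchange their roles. *)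
suff : infinite_packing (flip E) unrelated.
  move=> [o /packing_flip_unrelated pk].
  by exists (mix (fun i p => o i (Posz p)) (fun i p => o i (Negz p))).
have flipS S : unbounded_packing (restrict (flip E) S) unrelated ->
    unbounded_packing (restrict E S) unrelated.
  by move/unbounded_flip; apply: unbounded_mono => // u v [].
have flipS' S : unbounded_packing (restrict E S) unrelated ->
    unbounded_packing (restrict (flip E) S) unrelated.
  by move/unbounded_flip; apply: unbounded_mono => // u v [].
apply: (nested_packing (flipS' _ ubS0)) => [S a SS /flipS ubS ra|S SS0 /flipS ubS].
  by apply: (noS0 S a SS ubS); apply: is_ray_mono ra => u v [].
have [X [U [W [a [r [fX part [UW arcs] [[ast ainj] aU [rst_ rinj] rW] [/inside big|
  /inside big]]]]]]] := split_ S ubS; last first.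
  exists (S `&` W), X, a; split=> //.
  - exact: flipS'.
  - split=> // p; have [e h1 h2] := ast p.
    by split=> //; (split=> //; move=> [_]; exact: UW).
  move=> u v e [Su Wu] Sv nS'; have [//|Uv|Wv] := part v; last by case: nS'.
  by case: (arcs v u).
case: (noS0 (S `&` U) r) => //; first by move=> v [/SS0].
split=> // p; have [e h1 h2] := rst_ p.
by split=> //; (split; [exact: SS0|move=> [_ Ux]; apply: (UW _ Ux); exact: rW]).
Qed.
End RayAntiray.
Arguments unrelated {V} u v.

(** * Double rays without infinite packings *)

Section DoubleRays.
Variable V : Type.
Implicit Types (E L : V -> V -> Prop) (S U W X Y Z A B : set V).

Lemma packing_restrict_link E S K o : packing (restrict E S) E K o ->
  packing (restrict E S) (restrict E S) K o.
Proof.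
move=> [r a d l]; split=> // i Ki; split; first exact: l.
  by have [] := a.1 i 0 Ki.
by have [] := r.1 i 0 Ki.
Qed.

Definition undivided E : Prop := forall S d,
  unbounded_packing (restrict E S) (restrict E S) -> packing E E `I_1 (fun=> d) ->
  exists z, S (d z).

(** If every restriction with large packings could be divided, a double ray could be peeled off at
    each step, producing infinitely many. *)
Lemma exists_undivided E : unbounded_packing E E -> ~ infinite_packing E E ->
  exists S, unbounded_packing (restrict E S) (restrict E S) /\ undivided (restrict E S).
Proof.
move=> ub ninf; apply: contrapT => no; apply: ninf; apply: descending_packing ub => S ubS.
apply: contrapT => nS; apply: no; exists S; split.
  by move=> n; have [o /packing_restrict_link pk] := ubS n; exists o.
move=> S' d ubS' pk; apply: contrapT => nd; apply: nS; exists (S `&` S'); split=> //.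
- by apply: unbounded_mono ubS' => u v; [exact: restrictI | case=> -[]].
exists d; have [[rs ri] [as_ ai] d' l] := pk.
have out z : ~ S' (d z) by move=> ?; apply: nd; exists z.
split=> //; last by move=> i Ki; case: (l i Ki).
- split=> // i p Ki; have [e Su Sv] := rs i p Ki.
  by split=> //; split=> // -[_ /out].
- split=> // i p Ki; have [e Su Sv] := as_ i p Ki.
  by split=> //; split=> // -[_ /out].
Qed.

Lemma packing1_of E L n o i : packing E L `I_n o -> i < n -> packing E L `I_1 (fun=> o i).
Proof.
move=> pk i_n; apply: (packing_sub (h := fun=> i) _ _ pk) => //.
by move=> [|//] [|//].
Qed.

(** A double ray has no preferred origin, so a rare property remains rare when allowed for any
    translate. *)
Lemma most_shift E P : most E E (fun d => ~ P d) ->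
  most E E (fun d => ~ exists z0 : int, P (fun z => d (z + z0)%R)).
Proof.
move=> [m Hm]; exists m => o pk; apply: contrapT => no.
have h i : exists z0 : int, i < m -> P (fun z => o i (z + z0)%R).
  have [im|] := ltnP i m; last by exists 0%R.
  have [z0 hz] : exists z0 : int, P (fun z => o i (z + z0)%R).
    by apply: contrapT => ni; apply: no; exists i.
  by exists z0.
have [f Hf] := choice h.
by have [i im] := Hm _ (packing_shift f pk); apply; exact: Hf.
Qed.

(** No arc leads from U to W, so a double ray meeting both passes once from W to U. Translated to
    that place it would have its ray in U and its anti-ray in W. *)
Lemma one_side E U W d : packing E E `I_1 (fun=> d) ->
  (forall z, U (d z) \/ W (d z)) -> (forall v, U v -> ~ W v) ->
  (forall u v, E u v -> U u -> ~ W v) ->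
  ~ (exists z0 : int, (forall p : nat, U (d (Posz p + z0)%R)) /\
                      (forall p : nat, W (d (Negz p + z0)%R))) ->
  (forall z, U (d z)) \/ (forall z, W (d z)).
Proof.
move=> pk UoW UW arcs ncr.
have st z : E (d z) (d (z + 1)%R) by exact: (packing_step z pk (isT : `I_1 0)).
have up y (p : nat) : U (d y) -> U (d (y + p%:Z)%R).
  move=> Uy; elim: p => [|p IH]; first by rewrite addr0.
  have -> : (y + p.+1%:Z = y + p%:Z + 1)%R by lia.
  by have [//|/(arcs _ _ (st _) IH)] := UoW (y + p%:Z + 1)%R.
have down y (p : nat) : W (d y) -> W (d (y - p%:Z)%R).
  move=> Wy; have [/(up _ p)|//] := UoW (y - p%:Z)%R.
  by rewrite subrK => /UW.
have [aW|nW] := pselect (forall z, W (d z)); [by right|left].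
have [z0 Uz0] : exists z0, U (d z0).
  by apply: contrapT => no; apply: nW => z; have [?|//] := UoW z; case: no; exists z.
apply: contrapT => nU.
have [z1 Wz1] : exists z1, W (d z1).
  by apply: contrapT => no; apply: nU => z; have [//|?] := UoW z; case: no; exists z.
have lt : (z1 < z0)%R.
  rewrite ltNge; apply/negP => le; apply: (UW (d z1)) => //.
  by have := up _ (`|z1 - z0|%N) Uz0; have -> : (z0 + `|z1 - z0|%N%:Z = z1)%R by lia.
have exp : exists p, `[< U (d (z1 + p%:Z)%R) >].
  by exists (`|z0 - z1|%N); apply/asboolP; have -> : (z1 + `|z0 - z1|%N%:Z = z0)%R by lia.
case: (ex_minnP exp) => m /asboolP Um mmin; apply: ncr; exists (z1 + m%:Z)%R; split=> p.
  by rewrite addrC; exact: up.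
have m0 : 0 < m by case: m Um {mmin} => //; rewrite addr0 => /UW.
have Wm : W (d (z1 + m.-1%:Z)%R).
  have [Um1|//] := UoW (z1 + m.-1%:Z)%R.
  by have := mmin m.-1 (asboolT Um1); lia.
by have := down _ p Wm; have -> : (z1 + m.-1%:Z - p%:Z = Negz p + (z1 + m%:Z))%R by lia.
Qed.

Definition incident E : set V := [set v | exists w, E v w \/ E w v].

Definition richly_linked E F : Prop := forall X B B', finite_set X ->
  infinite_set B -> infinite_set B' -> B `<=` incident F -> B' `<=` incident F ->
  linked E (~` X) B B'.

(** * Finite separations of undivided digraphs *)

Section Undivided.
Variable E : V -> V -> Prop.
Hypotheses (ub : unbounded_packing E E) (ninf : ~ infinite_packing E E) (undiv : undivided E).

(** Most double rays avoid X and stay on one side. If neither side were negligible, W would contain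
    large packings while some double ray lies in U, against [undiv]. *)
Lemma separation_negligible X U W : finite_set X -> (forall v, [\/ X v, U v | W v]) ->
  (forall v, U v -> ~ W v) -> (forall u v, E u v -> U u -> ~ W v) ->
  negligible E E U \/ negligible E E W.
Proof.
move=> fX part UW arcs; apply: contrapT => /not_orP [nU nW].
pose tame d := avoids X d /\ ~ exists z0 : int, (forall p : nat, U (d (Posz p + z0)%R)) /\
                      (forall p : nat, W (d (Negz p + z0)%R)).
have mt : most E E tame.
  exact: most_and (most_avoids_finite E E fX) (most_shift (most_crossing UW ninf)).
have side d : packing E E `I_1 (fun=> d) -> tame d -> (forall z, U (d z)) \/ (forall z, W (d z)).
  move=> pk [dX ncr]; apply: (one_side pk) => // z.
  by have [/dX|?|?] := part (d z); [|left|right].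
have touch Z N : ~ negligible E E Z -> exists o, [/\ packing E E `I_N o,
    forall i, i < N -> tame (o i) & forall i, i < N -> exists z, Z (o i z)].
  move=> nZ; have [m Hm] := select_most N mt; have [o [pk oZ]] := not_most nZ m.
  have [h [hm hinj ht]] := Hm o pk; exists (fun i => o (h i)); split=> //.
    exact: packing_sub pk.
  move=> i iN; apply: contrapT => no; apply: (oZ (h i)); first exact: hm.
  by move=> z Zz; apply: no; exists z.
have ubW : unbounded_packing (restrict E W) (restrict E W).
  move=> N; have [o [pk tm oW]] := touch W N nW; exists o.
  have oW' i z : i < N -> W (o i z).
    move=> iN; have [y Wy] := oW i iN.
    by have [hU|] := side _ (packing1_of pk iN) (tm i iN); [case: (UW _ (hU y))|].
  apply: double_packing => [i z iN|i j y z iN jN]; last exact: packing_inj pk _ _.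
  by split; [exact: packing_step pk _ | exact: oW' | exact: oW'].
have [o [pk tm oU]] := touch U 1 nU.
have pk1 := packing1_of pk (isT : 0 < 1).
have [z Wz] := undiv ubW pk1; have [y Uy] := oU 0 isT.
have [hU|hW] := side _ pk1 (tm 0 isT); first by apply: UW (hU z) Wz.
by apply: UW Uy (hW y).
Qed.

Definition heavy (d : int -> V) : Prop :=
  ~ negligible E E (range (fun p : nat => d (Posz p))) /\
  ~ negligible E E (range (fun p : nat => d (Negz p))).

Lemma most_heavy : most E E heavy.
Proof. exact: most_and (most_ray_heavy ninf) (most_antiray_heavy ninf). Qed.

(** The two alternatives cover the two sides of a separation with separator X. *)
Definition closed_off X U : Prop := (forall u v, E u v -> U u -> X v \/ U v) \/
  (forall u v, E u v -> U v -> X u \/ U u).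

Lemma tail_not_negligible U (s : nat -> V) p0 : negligible E E U ->
  ~ negligible E E (range s) -> ~ (forall p, p0 <= p -> U (s p)).
Proof.
move=> nU ns h; apply: ns.
apply: negligible_sub (negligible_setU nU (negligible_finite E E (finite_image s (finite_II p0)))).
move=> _ [p _ <-]; have [/h ?|pp] := leqP p0 p; [by left|by right; exists p].
Qed.

(** Beyond X the sequence either cannot leave U or cannot re-enter it. A tail inside the negligible
    U would make the whole range negligible. *)
Lemma leaves_negligible X U (s : nat -> V) : finite_set X -> injective s ->
  (forall p, U (s p) -> X (s p.+1) \/ U (s p.+1)) \/
  (forall p, U (s p.+1) -> X (s p) \/ U (s p)) ->
  negligible E E U -> ~ negligible E E (range s) ->
  exists p0, forall p, p0 <= p -> ~ U (s p).
Proof.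
move=> fX sinj cl nU ns; have [p0 h0] := eventually_avoids fX sinj.
case: cl => cl.
  exists p0 => p pp Up; apply: (tail_not_negligible (p0 := p) nU ns).
  elim=> [|q IH]; first by rewrite leqn0 => /eqP e; move: Up; rewrite e.
  rewrite leq_eqVlt => /orP[/eqP <- //|pq].
  have [/h0 h|//] := cl q (IH pq); case: h; lia.
have [p1 [pp1 n1]] : exists p1, p0 <= p1 /\ ~ U (s p1).
  apply: contrapT => no; apply: (tail_not_negligible (p0 := p0) nU ns) => p pp.
  by apply: contrapT => nUp; apply: no; exists p.
exists p1; elim=> [|p IH]; first by rewrite leqn0 => /eqP <-.
rewrite leq_eqVlt => /orP[/eqP <- //|pp] /cl [|]; last exact: IH.
by apply: h0; lia.
Qed.

Lemma heavy_closed_bounded X U d : packing E E `I_1 (fun=> d) -> heavy d ->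
  finite_set X -> closed_off X U -> negligible E E U ->
  exists b, forall z, U (d z) -> `|z|%N <= b.
Proof.
move=> pk [hr ha] fX cl nU; have [[rs ri] [as_ ai] _ _] := pk.
have i1 : `I_1 0 by [].
have [p0 h0] : exists p0, forall p, p0 <= p -> ~ U (d (Posz p)).
  apply: (leaves_negligible (s := fun p => d (Posz p)) fX _ _ nU hr).
    by move=> p q /(ri 0 0 _ _ i1 i1) [].
  by case: cl => cl; [left|right] => p; apply: cl; exact: (rs 0).
have [p1 h1] : exists p1, forall p, p1 <= p -> ~ U (d (Negz p)).
  apply: (leaves_negligible (s := fun p => d (Negz p)) fX _ _ nU ha).
    by move=> p q /(ai 0 0 _ _ i1 i1) [].
  by case: cl => cl; [right|left] => p; apply: cl; exact: (as_ 0).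
exists (p0 + p1).+1 => -[p|p] Up.
  by have [/h0|] := leqP p0 p; last lia.
by have [/h1|] := leqP p1 p; last lia.
Qed.

(** Avoiding X, a double ray that enters U would remain there in one direction, against
    [heavy_closed_bounded]. *)
Lemma heavy_closed_disjoint X U d : packing E E `I_1 (fun=> d) -> heavy d ->
  finite_set X -> avoids X d -> closed_off X U -> negligible E E U -> avoids U d.
Proof.
move=> pk hd fX dX cl nU z Uz.
have st y : E (d y) (d (y + 1)%R) by exact: (packing_step y pk (isT : `I_1 0)).
have [b hb] := heavy_closed_bounded pk hd fX cl nU.
case: cl => cl.
  have up (p : nat) : U (d (z + p%:Z)%R).
    elim: p => [|p IH]; first by rewrite addr0.
    have -> : (z + p.+1%:Z = z + p%:Z + 1)%R by lia.
    by have [/dX|] := cl _ _ (st _) IH.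
  by have := hb _ (up (`|z|%N + b.+1)); lia.
have down (p : nat) : U (d (z - p%:Z)%R).
  elim: p => [|p IH]; first by rewrite subr0.
  have := cl _ _ (st (z - p.+1%:Z)%R).
  have -> : (z - p.+1%:Z + 1 = z - p%:Z)%R by lia.
  by move=> /(_ IH) [/dX|].
by have := hb _ (down (`|z|%N + b.+1)); lia.
Qed.

Lemma finite_bigcup_lt T n (F : nat -> set T) : (forall k, k < n -> finite_set (F k)) ->
  finite_set [set v | exists2 k, k < n & F k v].
Proof.
move=> fF; apply: sub_finite_set (bigcup_finite (finite_II n) fF).
by move=> v [k kn Fv]; exists k.
Qed.

(** Blocks may intersect far out, but avoiding ever larger windows of the earlier ones makes their
    union locally finite. *)
Lemma heavy_blocks : exists u : nat -> nat -> int -> V, forall n,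
  [/\ packing E E `I_n (u n), forall i, i < n -> heavy (u n i)
    & forall k i j y z, k < n -> i < k -> `|y|%N <= n -> j < n -> u n j z <> u k i y].
Proof.
have [|u Hu] := @history_choice (nat -> int -> V) (fun s x =>
  [/\ packing E E `I_(size s) x, forall i, i < size s -> heavy (x i)
    & forall k i j y z, k < size s -> i < k -> `|y|%N <= size s -> j < size s ->
        x j z <> nth x s k i y]).
  move=> s; have [o0 _] := ub 0.
  pose F k := [set v | exists i z, [/\ i < k, `|z|%N <= size s & v = nth o0 s k i z]].
  have fF : finite_set [set v | exists2 k, k < size s & F k v].
    by apply: finite_bigcup_lt => k _; exact: finite_window.
  have [o [pk ho]] := most_unbounded (size s) ub (most_and most_heavy (most_avoids_finite E E fF)).
  exists o; split=> [//|i /ho []//|k i j y z ks ik yn jn e].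
  have [_ /(_ z)] := ho j jn; apply; exists k => //; exists i, y; split=> //.
  by rewrite e (set_nth_default o0).
exists u => n; have := Hu n; rewrite size_mkseq => -[pk hn dn]; split=> // k i j y z kn ik yn jn.
by have := dn k i j y z kn ik yn jn; rewrite nth_mkseq.
Qed.

(** F is the union of the blocks. If X separated B from B', one side would be negligible and so
    contain only finitely many vertices of the blocks, yet it contains all of B or B' outside X. *)
Lemma richly_linked_subrelation : exists F : V -> V -> Prop,
  [/\ forall u v, F u v -> E u v, unbounded_packing F unrelated & richly_linked E F].
Proof.
have [u Hu] := heavy_blocks.
pose T := [set v | exists n i z, i < n /\ v = u n i z].
pose F v w := exists n i z, [/\ i < n, v = u n i z & w = u n i (z + 1)%R].
have FT : incident F `<=` T.
  move=> v [w [[n [i [z [i_n -> _]]]]|[n [i [z [i_n _ ->]]]]]]; first by exists n, i, z.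
  by exists n, i, (z + 1)%R.
have locfin X : finite_set X -> exists N, forall n i, N <= n -> i < n -> avoids X (u n i).
  move: X; apply: finite_set_elim => [|x X [N hN]]; first by exists 0 => n i _ _ z [].
  have [[n0 [i0 [z0 [i0n xE]]]]|nT] := pselect (T x); last first.
    exists N => n i Nn i_n z [e|]; last exact: hN.
    by apply: nT; exists n, i, z.
  (* Blocks with larger index come after block n0 and avoid a window of it that contains x. *)
  exists (N + n0.+1 + `|z0|%N) => n i Nn i_n z [e|]; last by apply: hN; lia.
  have [_ _ d] := Hu n; apply: (d n0 i0 i z0 z) => //; first by lia.
    by lia.
  by rewrite -xE.
(* Late blocks avoid X and therefore U; each of the finitely many other double rays meets U in a
   bounded part. *)
have finT X U : finite_set X -> closed_off X U -> negligible E E U -> finite_set (U `&` T).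
  move=> fX cl nU; have [N hN] := locfin X fX.
  pose G n i := [set v | exists2 z, U (u n i z) & v = u n i z].
  have fG n i : i < n -> finite_set (G n i).
    move=> i_n; have [pk hv _] := Hu n; have pk1 := packing1_of pk i_n.
    have [b hb] := heavy_closed_bounded pk1 (hv i i_n) fX cl nU.
    apply: sub_finite_set (finite_window (fun=> u n i) 1 b).
    by move=> v [z Uz ->]; exists 0, z; split=> //; exact: hb.
  apply: sub_finite_set (finite_bigcup_lt (n := N)
    (F := fun n => [set v | exists2 i, i < n & G n i v]) _); last first.
    by move=> n _; apply: finite_bigcup_lt => i; exact: fG.
  move=> v [Uv [n [i [z [i_n vE]]]]].
  have [Nn|nN] := leqP N n.
    have [pk hv _] := Hu n; have pk1 := packing1_of pk i_n.
    case: (heavy_closed_disjoint pk1 (hv i i_n) fX (hN n i Nn i_n) cl nU (z := z)).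
    by rewrite -vE.
  by exists n => //; exists i => //; exists z => //; rewrite -vE.
exists F; split.
- move=> _ _ [n [i [z [i_n -> ->]]]]; have [pk _ _] := Hu n; exact: (packing_step z pk i_n).
- move=> n; exists (u n); have [pk _ _] := Hu n.
  apply: packingI => // [i p i_n|i p i_n|i j y z]; last exact: packing_inj pk.
    by exists n, i, (Posz p); split=> //; congr (u n i _); lia.
  by exists n, i, (Negz p.+1); split=> //; congr (u n i _); lia.
move=> X B B' fX iB iB' BT B'T; apply: contrapT => nl.
pose U := reachable E X B; pose W := ~` X `\` U.
have infD Z : infinite_set Z -> infinite_set (Z `\` X).
  move=> iZ fZ; apply: iZ; apply: sub_finite_set (_ : _ `<=` X `|` (Z `\` X)) _.
    by move=> v Zv; have [?|?] := pselect (X v); [left|right].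
  by rewrite finite_setU.
have [|||nU|nW] := @separation_negligible X U W fX.
- move=> v; have [?|?] := pselect (X v); first exact: Or31.
  by have [?|?] := pselect (U v); [exact: Or32|exact: Or33].
- by move=> v Uv [].
- by move=> v w vw Uv [nXw]; apply; exact: reachable_step vw nXw.
- apply: (infD B iB); apply: sub_finite_set (finT X U fX _ nU).
    by move=> v [Bv nX]; split; [exact: reachable_self | exact/FT/BT].
  left=> v w vw Uv; have [?|nX] := pselect (X w); first by left.
  by right; exact: reachable_step vw nX.
- apply: (infD B' iB'); apply: sub_finite_set (finT X W fX _ nW).
    move=> v [B'v nX]; split; last exact/FT/B'T.
    split=> // -[n [f [fw f0 fn]]]; apply: nl; exists n, f; split=> //.
    by rewrite fn.
  right=> v w vw [nXw nUw]; have [?|nX] := pselect (X v); first by left.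
  right; split=> // Uv; apply: nUw; exact: reachable_step vw nXw.
Qed.
End Undivided.
End DoubleRays.

(** * One-ended subdigraphs *)

Section Ears.
Variables (V : Type) (E F : V -> V -> Prop) (q : nat -> int -> V).
Implicit Types (X Z B : set V).
Hypothesis FE : forall u v, F u v -> E u v.
Hypothesis rich : richly_linked E F.
Hypothesis pk : packing F unrelated setT q.

Definition line l p : V := if odd l then q l./2 (Negz p) else q l./2 (Posz p).

Lemma line_inj l k p r : line l p = line k r -> l = k /\ p = r.
Proof.
rewrite /line; case ol: (odd l); case ok: (odd k) => /(packing_inj pk I I) [lk e];
  have := odd_double_half l; have := odd_double_half k; rewrite ol ok lk => *.
- by split; [lia | case: e].
- by [].
- by [].
- by split; [lia | case: e].
Qed.

Lemma line_step l p : if odd l then F (line l p.+1) (line l p) else F (line l p) (line l p.+1).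
Proof.
have [[rs _] [as_ _] _ _] := pk.
by rewrite /line; case: (odd l); [exact: as_ | exact: rs].
Qed.

Lemma line_incident l p : incident F (line l p).
Proof.
by exists (line l p.+1); have := line_step l p; case: odd; [right|left].
Qed.

(** An ear ties a line to the base by a walk from the base and a walk back, both attached at the
    vertex [position] of the line. *)
Record ear := Ear {
  in_len : nat; in_walk : nat -> V;
  out_len : nat; out_walk : nat -> V; position : nat }.

Definition ear_vset (e : ear) : set V := [set v |
  (exists2 p, p <= in_len e & v = in_walk e p) \/
  (exists2 p, p <= out_len e & v = out_walk e p)].

Definition is_ear X l (e : ear) : Prop :=
  [/\ walk E (~` X) (in_len e) (in_walk e), walk E (~` X) (out_len e) (out_walk e),
      range (line 0) (in_walk e 0), range (line 0) (out_walk e (out_len e))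
    & in_walk e (in_len e) = line l (position e) /\ out_walk e 0 = line l (position e)].

Lemma finite_ear_vset e : finite_set (ear_vset e).
Proof.
apply: sub_finite_set (_ : _ `<=` (in_walk e @` `I_(in_len e).+1) `|`
  (out_walk e @` `I_(out_len e).+1)) _.
  by move=> v [[p pl ->]|[p pl ->]]; [left|right]; exists p.
by rewrite finite_setU; split; apply/finite_image/finite_II.
Qed.

Lemma infinite_line_range l : infinite_set (range (line l)).
Proof.
move=> fin; have [] := eventually_avoids fin (_ : injective (line l)).
  by move=> p r /line_inj [].
by move=> p0 /(_ p0 (leqnn _)); apply; exists p0.
Qed.

(** By rich linkage only finitely many vertices of line l fail to be reached from the base outside
    X, or fail to reach it. Any late vertex of the line can carry the ear. *)
Lemma exists_ear X l p0 : finite_set X -> exists e, is_ear X l e /\ p0 <= position e.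
Proof.
move=> fX.
pose A1 := [set v | range (line l) v /\ ~ linked E (~` X) (range (line 0)) [set v]].
pose A2 := [set v | range (line l) v /\ ~ linked E (~` X) [set v] (range (line 0))].
have inc0 : range (line 0) `<=` incident F by move=> _ [p _ <-]; exact: line_incident.
have incl v : range (line l) v -> incident F v by move=> [p _ <-]; exact: line_incident.
have f1 : finite_set A1.
  apply: contrapT => inf.
  have [||n [f [fw f0 [_ nl]]]] := rich fX (@infinite_line_range 0) inf => //.
    by move=> v [/incl].
  by apply: nl; exists n, f.
have f2 : finite_set A2.
  apply: contrapT => inf.
  have [||n [f [fw [_ nl] fn]]] := rich fX inf (@infinite_line_range 0) => //.
    by move=> v [/incl].
  by apply: nl; exists n, f.
have [||p1 h] := @eventually_avoids _ (A1 `|` A2) (line l).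
- by rewrite finite_setU.
- by move=> p r /line_inj [].
have {}h := h (p0 + p1) (leq_addl _ _).
have [n [f [fw f0 fn]]] : linked E (~` X) (range (line 0)) [set line l (p0 + p1)].
  by apply: contrapT => nl; apply: h; left; split=> //; exists (p0 + p1).
have [m [g [gw g0 gm]]] : linked E (~` X) [set line l (p0 + p1)] (range (line 0)).
  by apply: contrapT => nl; apply: h; right; split=> //; exists (p0 + p1).
exists (Ear n f m g (p0 + p1)); split; last exact: leq_addr.
by split.
Qed.

(** Round m attaches an ear to each line up to m, disjoint from the ears of earlier rounds. Every
    line thus receives ears arbitrarily far out, none before its first one. *)
Lemma ear_sequence : exists e : nat -> nat -> ear, forall m l, l <= m ->
  [/\ is_ear [set v | exists2 k, k < m & exists2 j, j <= k & ear_vset (e k j) v] l (e m l),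
      m <= position (e m l) & position (e l l) <= position (e m l)].
Proof.
pose e0 : nat -> ear := fun=> Ear 0 (fun=> q 0 0) 0 (fun=> q 0 0) 0.
pose past (s : seq (nat -> ear)) :=
  [set v | exists2 k, k < size s & exists2 j, j <= k & ear_vset (nth e0 s k j) v].
have [|e He] := @history_choice (nat -> ear) (fun s x => forall l, l <= size s ->
  [/\ is_ear (past s) l (x l), size s <= position (x l)
    & position (nth e0 s l l) <= position (x l)]).
  move=> s.
  have fp : finite_set (past s).
    apply: (finite_bigcup_lt
      (F := fun k => [set v | exists2 j, j <= k & ear_vset (nth e0 s k j) v])).
    move=> k _; apply: (finite_bigcup_lt (n := k.+1) (F := fun j => ear_vset (nth e0 s k j))).
    by move=> j _; exact: finite_ear_vset.
  have [x Hx] := choice (fun l => exists_ear l (size s + position (nth e0 s l l)) fp).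
  by exists x => l ls; have [? ?] := Hx l; split=> //; lia.
exists e => m l lm; have := He m l; rewrite size_mkseq => /(_ lm) [ie mp pp]; split=> //.
  have <- // : past (mkseq e m) =
      [set v | exists2 k, k < m & exists2 j, j <= k & ear_vset (e k j) v].
  apply/seteqP; split=> v [k].
    by rewrite size_mkseq => km; rewrite nth_mkseq // => h; exists k.
  by move=> km h; exists k; rewrite ?size_mkseq ?nth_mkseq.
move: lm; rewrite leq_eqVlt => /orP[/eqP ->//|lm].
by move: pp; rewrite nth_mkseq.
Qed.

(** * The union of the lines and their ears *)

Section Union.
Variable e : nat -> nat -> ear.
Hypothesis He : forall m l, l <= m ->
  [/\ is_ear [set v | exists2 k, k < m & exists2 j, j <= k & ear_vset (e k j) v] l (e m l),
      m <= position (e m l) & position (e l l) <= position (e m l)].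

(* Each line other than the base line starts at its first ear, so that each of
   its vertices lies between two ears. *)
Definition start l := if l is 0 then 0 else position (e l l).

Definition union_arc u v : Prop :=
  [\/ exists l p, start l <= p /\
        if odd l then u = line l p.+1 /\ v = line l p else u = line l p /\ v = line l p.+1,
      exists m l p, [/\ l <= m, p < in_len (e m l),
        u = in_walk (e m l) p & v = in_walk (e m l) p.+1]
    | exists m l p, [/\ l <= m, p < out_len (e m l),
        u = out_walk (e m l) p & v = out_walk (e m l) p.+1]].

Lemma union_arc_sub u v : union_arc u v -> E u v.
Proof.
case=> [[l [p [_]]]|[m [l [p [/He [[[st _] _ _ _ _] _ _] pn -> ->]]]]|
  [m [l [p [/He [[_ [st _] _ _ _] _ _] pn -> ->]]]]]; [|exact: st|exact: st].
by have := line_step l p; case: odd => h [-> ->]; exact: FE.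
Qed.

Lemma union_incident v : incident union_arc v ->
  (exists l p, start l <= p /\ v = line l p) \/ (exists m l, l <= m /\ ear_vset (e m l) v).
Proof.
have h u w : union_arc u w ->
    ((exists l p, start l <= p /\ u = line l p) \/ (exists m l, l <= m /\ ear_vset (e m l) u)) /\
    ((exists l p, start l <= p /\ w = line l p) \/ (exists m l, l <= m /\ ear_vset (e m l) w)).
  case=> [[l [p [sp]]]|[m [l [p [lm pn -> ->]]]]|[m [l [p [lm pn -> ->]]]]].
  - case: (odd l) => -[-> ->]; split; left; exists l.
    + by exists p.+1; split=> //; exact: leqW.
    + by exists p.
    + by exists p.
    + by exists p.+1; split=> //; exact: leqW.
  - by split; right; exists m, l; split=> //; left; [exists p => //; exact: ltnW|exists p.+1].
  - by split; right; exists m, l; split=> //; right; [exists p => //; exact: ltnW|exists p.+1].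
by move=> [w [/h []|/h []]].
Qed.

Lemma start_le m l : l <= m -> start l <= position (e m l).
Proof. by case: l => // l lm; have [_ _ ?] := He lm. Qed.

Lemma segment_linked X l a b : (forall p, a <= p -> ~ X (line l p)) -> start l <= a -> a <= b ->
  if odd l then linked union_arc (~` X) [set line l b] [set line l a]
  else linked union_arc (~` X) [set line l a] [set line l b].
Proof.
move=> nX sa; elim: b => [|b IH].
  by rewrite leqn0 => /eqP e0; rewrite e0; case: odd; apply: linked_refl; apply: nX; rewrite e0.
rewrite leq_eqVlt => /orP[/eqP <-|ab].
  by case: odd; apply: linked_refl; exact: nX.
have arc : if odd l then union_arc (line l b.+1) (line l b) else union_arc (line l b) (line l b.+1).
  case ol: (odd l); apply: Or31; exists l, b; rewrite ol; split=> //; exact: leq_trans sa ab.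
have nb := nX b ab; have nb1 := nX b.+1 (leqW ab).
move: (IH ab) arc; case: odd => lk arc.
  by apply: linked_trans lk; exact: linked_step.
by apply: linked_trans lk _; exact: linked_step.
Qed.

Lemma walk_linked G Y n (f : nat -> V) a b : walk G Y n f -> a <= b -> b <= n ->
  linked G Y [set f a] [set f b].
Proof.
move=> [st fY] ab bn; exists (b - a), (fun p => f (a + p)).
split; rewrite /= ?addn0 ?subnKC //.
by split=> p pn; [rewrite addnS; apply: st | apply: fY]; lia.
Qed.

Definition base_linked X v :=
  linked union_arc (~` X) (range (line 0)) [set v] /\
  linked union_arc (~` X) [set v] (range (line 0)).

(** The two walks of an ear share the vertex on the line, so together they lead from the base
    through all of the ear back to the base. *)
Lemma ear_base_linked X m l v : l <= m -> ear_vset (e m l) v ->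
  (forall u, ear_vset (e m l) u -> ~ X u) -> base_linked X v.
Proof.
move=> lm ev nX; have [[[_ _] [_ _] i0 on [ci co]] _ _] := He lm.
set ea := e m l in ev nX i0 on ci co *.
have wi : walk union_arc (~` X) (in_len ea) (in_walk ea).
  split=> p pn; first by apply: Or32; exists m, l, p.
  by apply: nX; left; exists p.
have wo : walk union_arc (~` X) (out_len ea) (out_walk ea).
  split=> p pn; first by apply: Or33; exists m, l, p.
  by apply: nX; right; exists p.
have fromi p : p <= in_len ea -> linked union_arc (~` X) (range (line 0)) [set in_walk ea p].
  move=> pn; apply: linked_sub (walk_linked wi (leq0n p) pn) => //.
  by move=> _ ->.
have too p : p <= out_len ea -> linked union_arc (~` X) [set out_walk ea p] (range (line 0)).
  move=> pn; apply: linked_sub (walk_linked wo pn (leqnn _)) => //.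
  by move=> _ ->.
have cc : in_walk ea (in_len ea) = out_walk ea 0 by rewrite ci co.
case: ev => -[p pn ->]; split.
- exact: fromi.
- apply: linked_trans (walk_linked wi pn (leqnn _)) _.
  by rewrite cc; exact: too.
- apply: linked_trans (fromi _ (leqnn _)) _.
  by rewrite cc; exact: walk_linked wo _ _.
- exact: too.
Qed.

Lemma ear_position m l : l <= m -> ear_vset (e m l) (line l (position (e m l))).
Proof. by move=> lm; have [[_ _ _ _ [<- _]] _ _] := He lm; left; exists (in_len (e m l)). Qed.

(** Ears of different rounds are disjoint, so each vertex of X lies on ears of at most one round. *)
Lemma ears_avoid X : finite_set X ->
  exists m0, forall m l v, m0 <= m -> l <= m -> ear_vset (e m l) v -> ~ X v.
Proof.
move: X; apply: finite_set_elim => [|x X [m0 h]]; first by exists 0 => m l v _ _ _ [].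
have [[k [j [jk xe]]]|no] := pselect (exists k j, j <= k /\ ear_vset (e k j) x); last first.
  exists m0 => m l v mm lm ev [vx|]; last exact: h ev.
  by apply: no; exists m, l; rewrite -vx.
exists (maxn m0 k.+1) => m l v; rewrite geq_max => /andP[mm km] lm ev [vx|]; last exact: h ev.
have [[[_ ni] [_ no] _ _ _] _ _] := He lm.
have out w : w = x ->
    ~ [set v | exists2 k, k < m & exists2 j, j <= k & ear_vset (e k j) v] w -> False.
  by move=> ->; apply; exists k => //; exists j.
by case: ev => -[p pn vE]; [apply: (out _ _ (ni p pn))|apply: (out _ _ (no p pn))]; rewrite -vE.
Qed.

Lemma lines_avoid X : finite_set X -> exists p0, forall l p, p0 <= p -> ~ X (line l p).
Proof.
move: X; apply: finite_set_elim => [|x X [p0 h]]; first by exists 0 => l p _ [].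
have [[k [r xe]]|no] := pselect (exists k r, line k r = x); last first.
  by exists p0 => l p pp [e1|]; [apply: no; exists l, p | exact: h].
exists (maxn p0 r.+1) => l p; rewrite geq_max => /andP[pp rp] [e1|]; last exact: h.
by have [_ pr] := line_inj (etrans e1 (esym xe)); move: rp; rewrite pr ltnn.
Qed.

(** A vertex far out on a line lies between two ears avoiding X: the line leads to it from one and
    from it to the other. Exceptions are X, the ears of early rounds and initial segments of
    finitely many lines, since each later line starts at its own first ear. *)
Lemma cofinitely_base_linked X : finite_set X -> exists2 Z, finite_set Z &
  forall v, incident union_arc v -> ~ Z v -> base_linked X v.
Proof.
move=> fX; have [m0 hm] := ears_avoid fX; have [p0 hp] := lines_avoid fX.
(* From c on, both the ears of a round and the line vertices at their positions or beyond avoid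
   X. *)
pose c := m0 + p0.
pose Z1 := [set v | exists2 m, m < m0 & exists2 l, l < m.+1 & ear_vset (e m l) v].
pose Z2 := [set v | exists l p, [/\ l < c, p <= position (e (maxn l c) l) & v = line l p]].
exists (X `|` (Z1 `|` Z2)).
  rewrite !finite_setU; split=> //; split; last exact: finite_walks.
  apply: finite_bigcup_lt => m _; apply: finite_bigcup_lt => l _; exact: finite_ear_vset.
move=> v /union_incident vE /not_orP [nX /not_orP [nZ1 nZ2]].
case: vE => [[l [p [sp vE]]]|[m [l [lm ev]]]]; last first.
  apply: (ear_base_linked lm ev) => u; apply: hm => //.
  by rewrite leqNgt; apply/negP => mm; apply: nZ1; exists m => //; exists l.
have [l0|lpos] := posnP l.
  by split; exists 0, (fun=> v); split=> //; exists p => //; rewrite vE l0.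
(* The ear of round m is attached at a, before p; the ear of round [maxn m p] is attached at b, not
   before p. *)
pose m := maxn l c; pose a := position (e m l).
have lm : l <= m by exact: leq_maxl.
have cm : c <= m by exact: leq_maxr.
have ma : m <= a by have [] := He lm.
have ap : a <= p.
  have [lc|cl] := ltnP l c.
    by rewrite leqNgt; apply/negP => pa; apply: nZ2; exists l, p; split=> //; exact: ltnW.
  have ml : m = l by apply/maxn_idPl.
  by move: sp; rewrite /a ml; case: (l) lpos.
have lm' : l <= maxn m p by rewrite leq_max lm.
pose b := position (e (maxn m p) l).
have pb : p <= b by have [_ h _] := He lm'; apply: leq_trans h; exact: leq_maxr.
have nX' r : a <= r -> ~ X (line l r) by move=> ar; apply: hp; lia.
have sa : start l <= a by exact: start_le.
have [ba1 ba2] : base_linked X (line l a).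
  by apply: (ear_base_linked lm (ear_position lm)) => u; apply: hm => //; lia.
have [bb1 bb2] : base_linked X (line l b).
  apply: (ear_base_linked lm' (ear_position lm')) => u; apply: hm => //.
  by rewrite leq_max; apply/orP; left; lia.
have := segment_linked nX' sa ap.
have := @segment_linked X l p b (fun r pr => nX' r (leq_trans ap pr)) (leq_trans sa ap) pb.
rewrite vE; case: odd => s1 s2; split.
- exact: linked_trans bb1 s1.
- exact: linked_trans s2 ba2.
- exact: linked_trans ba1 s2.
- exact: linked_trans s1 bb2.
Qed.

(** The walk goes from B to the base, along the base, and from the base to B'. *)
Lemma union_richly_linked : richly_linked union_arc union_arc.
Proof.
move=> X B B' fX iB iB' Binc B'inc.
have pick Z C : finite_set Z -> infinite_set C -> exists2 v, C v & ~ Z v.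
  move=> fZ iC; apply: contrapT => no; apply: iC; apply: sub_finite_set fZ.
  by move=> v Cv; apply: contrapT => nZ; apply: no; exists v.
have fseg n : finite_set [set v | exists2 p, p < n & v = line 0 p].
  by apply: sub_finite_set (finite_image (line 0) (finite_II n)) => v [p pn ->]; exists p.
have [p0 hp] := lines_avoid fX.
pose X1 := X `|` [set v | exists2 p, p < p0 & v = line 0 p].
have fX1 : finite_set X1 by rewrite finite_setU.
have [Z1 fZ1 HZ1] := cofinitely_base_linked fX1.
have [b Bb nZb] := pick Z1 B fZ1 iB.
have [_ [n [f [[fst_ fX'] f0 [k _ fk]]]]] := HZ1 b (Binc b Bb) nZb.
have pk0 : p0 <= k.
  rewrite leqNgt; apply/negP => kp; apply: (fX' n (leqnn n)); right.
  by exists k.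
(* The base can only be followed forwards; forbidding its vertices before k forces the second walk
   to leave it at some r not before k. *)
pose X2 := X `|` [set v | exists2 p, p < k & v = line 0 p].
have fX2 : finite_set X2 by rewrite finite_setU.
have [Z2 fZ2 HZ2] := cofinitely_base_linked fX2.
have [b' Bb' nZb'] := pick Z2 B' fZ2 iB'.
have [[m [g [[gst gX'] [r _ gr] gm]]] _] := HZ2 b' (B'inc b' Bb') nZb'.
have kr : k <= r.
  by rewrite leqNgt; apply/negP => rk; apply: (gX' 0 (leq0n m)); right; exists r.
apply: (@linked_trans _ _ _ _ _ (line 0 k)).
  exists n, f; split=> //; last by rewrite f0.
  by split=> // p pn Xp; apply: (fX' p pn); left.
apply: (@linked_trans _ _ _ _ _ (line 0 r)).
  have nX p : k <= p -> ~ X (line 0 p) by move=> kp; apply: hp; exact: leq_trans pk0 kp.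
  by have := @segment_linked X 0 k r nX (leq0n k) kr.
exists m, g; split=> //; last by rewrite gm.
by split=> // p pn Xp; apply: (gX' p pn); left.
Qed.

Lemma union_packing : infinite_packing union_arc unrelated.
Proof.
exists (mix (fun i p => line i.*2.+1 (start i.*2.+1 + p)) (fun i p => line i.*2 (start i.*2 + p))).
split=> //.
- split=> [i p _|i j p r _ _ /line_inj [ij pr]].
    apply: Or31; exists i.*2, (start i.*2 + p); rewrite leq_addr odd_double /=.
    by rewrite addnS.
  have ij' : i = j by lia.
  by subst j; split=> //; lia.
- split=> [i p _|i j p r _ _ /line_inj [ij pr]].
    apply: Or31; exists i.*2.+1, (start i.*2.+1 + p); rewrite leq_addr /= odd_double /=.
    by rewrite addnS.
  have ij' : i = j by lia.
  by subst j; split=> //; lia.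
- by move=> i j p r _ _ /line_inj []; lia.
Qed.
End Union.

Lemma richly_linked_packing : exists G : V -> V -> Prop,
  [/\ forall u v, G u v -> E u v, infinite_packing G unrelated & richly_linked G G].
Proof.
have [e He] := ear_sequence; exists (union_arc e); split.
- exact: union_arc_sub.
- exact: union_packing.
- exact: union_richly_linked.
Qed.
End Ears.

(** * Digraphs and relations *)

Lemma choice_on T (K : set nat) (P : nat -> T -> Prop) : K 0 ->
  (forall i, K i -> exists y, P i y) -> exists f : nat -> T, forall i, K i -> P i (f i).
Proof.
move=> K0 h; have [y0 _] := h 0 K0.
have [i|f Hf] := @choice _ _ (fun i y => K i -> P i y).
  by have [/h [y ?]|?] := pselect (K i); [exists y | exists y0].
by exists f.
Qed.

Lemma enum_card_le T (K : set nat) (A : set T) (x0 : T) : K #<= A ->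
  exists f : nat -> T, (forall i, K i -> A (f i)) /\
    (forall i j, K i -> K j -> f i = f j -> i = j).
Proof.
move=> /card_leP [g].
pose f i := if pselect (K i) is left Ki then val (g (SigSub (mem_set Ki))) else x0.
exists f; split=> [i Ki|i j Ki Kj]; rewrite /f.
  by case: pselect => // Ki'; exact: set_valP.
case: pselect => // Ki'; case: pselect => // Kj' /val_inj /inj e.
by have := e (mem_set I) (mem_set I) => /(congr1 val).
Qed.

Section Digraphs.
Variable V : Type.
Implicit Types (E : V -> V -> Prop) (D R : digraph V) (K : set nat) (B X : set V).

Definition relation_digraph E : digraph V :=
  @Digraph V (incident E) E
    (fun u v uv => conj (ex_intro _ v (or_introl uv)) (ex_intro _ u (or_intror uv))).

Definition walk_digraph (n : nat) (f : nat -> V) : digraph V.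
Proof.
refine (@Digraph V (f @` `I_n.+1) (fun u v => exists2 i, i < n & u = f i /\ v = f i.+1) _).
by move=> u v [i i_n [-> ->]]; split; [exists i => //=; exact: leqW|exists i.+1].
Defined.

(** Taking [S] on the naturals gives rays, and adding 1 on the integers gives double rays. *)
Definition line_digraph (I : Type) (next : I -> I) (f : I -> V) : digraph V.
Proof.
refine (@Digraph V (range f) (fun u v => exists i, u = f i /\ v = f (next i)) _).
by move=> u v [i [-> ->]]; split; [exists i|exists (next i)].
Defined.

Lemma walk_dipath n (f : nat -> V) : (forall p q, p <= n -> q <= n -> f p = f q -> p = q) ->
  dipath (f 0) (f n) (walk_digraph n f).
Proof.
move=> finj; exists n, f; split=> // p q.
by rewrite !in_setE => /= pn qn; apply: finj.
Qed.

Lemma walk_subdigraph D n (f : nat -> V) : (forall p, p < n -> arc D (f p) (f p.+1)) ->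
  vset D (f 0) -> subdigraph (walk_digraph n f) D.
Proof.
move=> st f0; split=> [_ [[|p] /= pn <-]|u v [p pn [-> ->]]] //; last exact: st.
by have [] := arc_vset (st p pn).
Qed.

Lemma has_dipath_walk D n (f : nat -> V) :
  (forall p q, p <= n -> q <= n -> f p = f q -> p = q) ->
  (forall p, p < n -> arc D (f p) (f p.+1)) -> vset D (f 0) -> has_dipath D (f 0) (f n).
Proof.
by move=> finj st f0; exists (walk_digraph n f); [exact: walk_subdigraph | exact: walk_dipath].
Qed.

Definition ray_digraph (f : nat -> V) := line_digraph S f.

Lemma ray_digraphP f : injective f -> ray (ray_digraph f).
Proof.
move=> finj; exists (f 0); split.
- by exists 0.
- exists (f 1); split; first by exists 0.
  by move=> w [p [/finj <- ->]].
- by move=> u [p [_ /finj]].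
- move=> _ [n _ <-]; apply: has_dipath_walk.
  + by move=> p q _ _ /finj.
  + by move=> p _; exists p.
  + by exists 0.
- move=> _ [p _ <-] np; split.
    exists (f p.+1); split; first by exists p.
    by move=> w [q [/finj <- ->]].
  case: p np => [//|p] _; exists (f p); split; first by exists p.
  by move=> u [q [-> /finj [->]]].
Qed.

Lemma ray_digraph_sub D f : is_ray (arc D) f -> subdigraph (ray_digraph f) D.
Proof.
move=> [st _]; split=> [_ [p _ <-]|u v [p [-> ->]]]; last exact: st.
by have [] := arc_vset (st p).
Qed.

(** Out-neighbours are iterated from the first vertex. A repetition could be traced back through
    unique in-neighbours to an arc into that vertex. *)
Lemma ray_param R : ray R -> exists f, is_ray (arc R) f /\ forall p, vset R (f p).
Proof.
move=> [v [Rv ov iv _ iR]].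
have out w : exists w', vset R w -> arc R w w'.
  have [Rw|?] := pselect (vset R w); last by exists w.
  have [->|wv] := pselect (w = v); first by have [w' []] := ov; exists w'.
  by have [[w' []]] := iR w Rw wv; exists w'.
have [s Hs] := choice out.
pose f p := iter p s v.
have fR p : vset R (f p).
  by elim: p => [//|p IH]; have [] := arc_vset (Hs _ IH).
have st p : arc R (f p) (f p.+1) by exact: Hs.
exists f; split=> //; split=> // p q; elim: p q => [|p IH] [|q] // e.
- by case: (iv (f q)); have := st q; rewrite -e.
- by case: (iv (f p)); have := st p; rewrite e.
- have [fv|/(iR _ (fR p.+1)) [_ [u [_ uq]]]] := pselect (f p.+1 = v).
    by case: (iv (f p)); have := st p; rewrite fv.
  congr _.+1; apply: IH; rewrite -(uq _ (st p)); apply: uq.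
  by rewrite e.
Qed.

Lemma antiray_param R : antiray R -> exists f, is_ray (flip (arc R)) f /\ forall p, vset R (f p).
Proof. exact: ray_param. Qed.

(** Pairwise disjointness of a union of two families does not rule out a common member, so this has
    to be excluded separately. *)
Lemma ray_not_antiray R : ray R -> ~ antiray R.
Proof.
move=> [v [_ ov _ _ oR]] [w [Rw _ iw _ _]].
have [wv|/(oR _ Rw) [[u [wu _]] _]] := pselect (w = v).
  by have [u [vu _]] := ov; case: (iw u); rewrite wv.
exact: iw wu.
Qed.

Lemma infinite_of_inj T (A : set T) (f : nat -> T) : injective f -> (forall p, A (f p)) ->
  infinite_set A.
Proof.
by move=> finj fA fin; have [p0 /(_ p0 (leqnn _))] := eventually_avoids fin finj; apply.
Qed.

(** Iterating out- and in-neighbours from any vertex reaches everything by connectedness. A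
    repetition would make the sequence periodic and the vertex set finite. *)
Lemma double_ray_param R : double_ray R ->
  exists d, packing (arc R) (arc R) `I_1 (fun=> d) /\ forall z, vset R (d z).
Proof.
move=> [infR deg con].
have [v0 Rv0] : exists v, vset R v.
  apply: contrapT => no; apply: infR; apply: sub_finite_set (finite_set0 V).
  by move=> v Rv; apply: no; exists v.
have outU u v w : arc R u v -> arc R u w -> v = w.
  move=> uv uw; have [[x [_ ux]] _] := deg u (arc_vset uv).1.
  by rewrite -(ux _ uv) -(ux _ uw).
have inU u v w : arc R v u -> arc R w u -> v = w.
  move=> vu wu; have [_ [x [_ ux]]] := deg u (arc_vset vu).2.
  by rewrite -(ux _ vu) -(ux _ wu).
have [w|s Hs] := @choice _ _ (fun w w' => vset R w -> arc R w w').
  have [Rw|?] := pselect (vset R w); last by exists w.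
  by have [[w' [ww' _]] _] := deg w Rw; exists w'.
have [w|r Hr] := @choice _ _ (fun w w' => vset R w -> arc R w' w).
  have [Rw|?] := pselect (vset R w); last by exists w.
  by have [_ [w' [ww' _]]] := deg w Rw; exists w'.
pose d (z : int) := match z with Posz p => iter p s v0 | Negz p => iter p.+1 r v0 end.
have Rd z : vset R (d z).
  case: z => p; elim: p => [|p IH] //=.
  - by have [] := arc_vset (Hs _ IH).
  - by have [] := arc_vset (Hr _ Rv0).
  - by have [] := arc_vset (Hr _ IH).
have st z : arc R (d z) (d (z + 1)%R).
  case: z => [p|[|p]].
  - have -> : (Posz p + 1)%R = Posz p.+1 by lia.
    exact: Hs _ (Rd (Posz p)).
  - exact: Hr.
  - have -> : (Negz p.+1 + 1)%R = Negz p by lia.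
    exact: Hr _ (Rd (Negz p)).
have st' z : arc R (d (z - 1)%R) (d z) by have := st (z - 1)%R; rewrite subrK.
have surj w : vset R w -> range d w.
  move=> Rw; case: (con v0 w Rv0 Rw) => -[P [_ PR] [n [f [_ f0 fn _ Parc]]]].
    have fd p : p <= n -> f p = d (Posz p).
      elim: p => [//|p IH] pn; have -> : Posz p.+1 = (Posz p + 1)%R by lia.
      apply: (outU (d (Posz p))); last exact: st.
      rewrite -(IH (ltnW pn)); apply: PR; apply/Parc.
      by exists p.
    by exists (Posz n) => //; rewrite -fd.
  have fd p : p <= n -> f (n - p) = d (- p%:Z)%R.
    elim: p => [|p IH] pn; first by rewrite subn0.
    apply: (inU (d (- p%:Z)%R)); last first.
      by have := st' (- p%:Z)%R; have -> : (- p%:Z - 1 = - p.+1%:Z)%R by lia.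
    rewrite -(IH (ltnW pn)); apply: PR; apply/Parc; exists (n - p.+1); first by lia.
    by split=> //; congr f; lia.
  by exists (- n%:Z)%R => //; rewrite -fd // subnn.
have dlt y z : (y < z)%R -> d y <> d z.
  move=> yz e; pose t := (z - y)%R.
  have fwd (p : nat) : d (y + p%:Z)%R = d (y + p%:Z + t)%R.
    elim: p => [|p IH]; first by rewrite addr0 e; congr d; rewrite /t; lia.
    have -> : (y + p.+1%:Z = y + p%:Z + 1)%R by lia.
    have -> : (y + p%:Z + 1 + t = y + p%:Z + t + 1)%R by lia.
    by apply: outU (st _) _; rewrite IH; exact: st.
  have bwd (p : nat) : d (y - p%:Z)%R = d (y - p%:Z + t)%R.
    elim: p => [|p IH]; first by rewrite subr0 e; congr d; rewrite /t; lia.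
    have -> : (y - p.+1%:Z = y - p%:Z - 1)%R by lia.
    have -> : (y - p%:Z - 1 + t = y - p%:Z + t - 1)%R by lia.
    by apply: inU (st' _) _; rewrite IH; exact: st'.
  have per x : d x = d (x + t)%R.
    have [xy|xy] := lerP y x.
      by have := fwd (`|x - y|%N); have -> : (y + `|x - y|%N%:Z = x)%R by lia.
    by have := bwd (`|x - y|%N); have -> : (y - `|x - y|%N%:Z = x)%R by lia.
  pose b := `|y|%N + `|z|%N.
  (* Indices are reduced by the period t, which is at most b, until they lie in the window of radius
     b. *)
  have small m x : `|x|%N <= b + m -> exists2 x', `|x'|%N <= b & d x = d x'.
    elim: m x => [|m IH] x xb; first by exists x; rewrite // addn0 in xb.
    have [?|bx] := leqP `|x|%N b; first by exists x.
    have [x0|x0] := lerP 0%R x.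
      have [|x' ? e'] := IH (x - t)%R; first by rewrite /t; lia.
      by exists x' => //; rewrite -e' [RHS]per subrK.
    have [|x' ? e'] := IH (x + t)%R; first by rewrite /t; lia.
    by exists x' => //; rewrite -e' [LHS]per.
  apply: infR; apply: sub_finite_set (finite_window (fun=> d) 1 b).
  move=> w /surj [x _ <-]; have [|x' ? ->] := small `|x|%N x; first by rewrite leq_addl.
  by exists 0, x'.
exists d; split=> //; apply: double_packing => [i z _|i j y z]; first exact: st.
case: i => [|//]; case: j => [|//] _ _ e; split=> //.
by case: (ltgtP y z) => // /dlt; [|move/nesym].
Qed.

Definition double_ray_digraph (d : int -> V) := line_digraph (fun z => z + 1)%R d.

Lemma double_ray_digraphP d : injective d -> double_ray (double_ray_digraph d).
Proof.
move=> dinj; split.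
- apply: (infinite_of_inj (f := fun p : nat => d (Posz p))); last by move=> p; exists (Posz p).
  by move=> p q /dinj [].
- move=> _ [z _ <-]; split.
    exists (d (z + 1)%R); split; first by exists z.
    by move=> w [y [/dinj -> ->]].
  exists (d (z - 1)%R); split; first by exists (z - 1)%R; rewrite subrK.
  by move=> w [y [-> /dinj ->]]; rewrite addrK.
have path y z : (y <= z)%R -> has_dipath (double_ray_digraph d) (d y) (d z).
  move=> yz;
  have := @has_dipath_walk (double_ray_digraph d) `|z - y|%N (fun p : nat => d (y + p%:Z)%R).
  have -> : (y + `|z - y|%N%:Z = z)%R by lia.
  rewrite addr0; apply.
  - by move=> p q _ _ /dinj; lia.
  - by move=> p _; exists (y + p%:Z)%R; split=> //; congr d; lia.
  - by exists y.
move=> _ _ [y _ <-] [z _ <-].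
by case: (lerP y z) => [?|/ltW ?]; [left|right]; exact: path.
Qed.

(** * Passing between sets of digraphs and packings *)

Let empty_digraph : digraph V := relation_digraph (fun _ _ => False).

Lemma packing_of_rays_antirays D K (RS AS : set (digraph V)) : K 0 ->
  K #<= RS -> K #<= AS -> disjoint_rays_antirays D RS AS ->
  exists o, packing (arc D) unrelated K o.
Proof.
move=> K0 /(enum_card_le empty_digraph) [F [FR Finj]] /(enum_card_le empty_digraph) [G [GA Ginj]].
move=> [hR hA tr].
have [r Hr] : exists r : nat -> nat -> V, forall i, K i ->
    is_ray (arc D) (r i) /\ forall p, vset (F i) (r i p).
  apply: (choice_on (P := fun i f => is_ray (arc D) f /\ forall p, vset (F i) (f p)) K0) => i Ki.
  have [[_ sub] /ray_param [f [rf vf]]] := hR _ (FR i Ki).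
  by exists f; split=> //; exact: is_ray_mono rf.
have [a Ha] : exists a : nat -> nat -> V, forall i, K i ->
    is_ray (flip (arc D)) (a i) /\ forall p, vset (G i) (a i p).
  apply: (choice_on (P := fun i f => is_ray (flip (arc D)) f /\
    forall p, vset (G i) (f p)) K0) => i Ki.
  have [[_ sub] /antiray_param [f [rf vf]]] := hA _ (GA i Ki).
  by exists f; split=> //; apply: is_ray_mono rf => u v; exact: sub.
exists (mix a r); split=> //.
- split=> [i p Ki|i j p q Ki Kj /= e]; first by have [[st _] _] := Hr i Ki; exact: st.
  have ij : i = j.
    apply: Finj => //; apply: tr; [by left; exact: FR|by left; exact: FR|].
    by exists (r i p); split; [exact: (Hr i Ki).2 | rewrite e; exact: (Hr j Kj).2].
  by subst j; have [[_ inj] _] := Hr i Ki; rewrite (inj _ _ e).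
- split=> [i p Ki|i j p q Ki Kj /= e]; first by have [[st _] _] := Ha i Ki; exact: st.
  have ij : i = j.
    apply: Ginj => //; apply: tr; [by right; exact: GA|by right; exact: GA|].
    by exists (a i p); split; [exact: (Ha i Ki).2 | rewrite e; exact: (Ha j Kj).2].
  by subst j; have [[_ inj] _] := Ha i Ki; rewrite (inj _ _ e).
- move=> i j p q Ki Kj /= e.
  have FG : F i = G j.
    apply: tr; [by left; exact: FR|by right; exact: GA|].
    by exists (r i p); split; [exact: (Hr i Ki).2 | rewrite e; exact: (Ha j Kj).2].
  have [_ rF] := hR _ (FR i Ki); have [_ aG] := hA _ (GA j Kj).
  by apply: (ray_not_antiray rF); rewrite FG.
Qed.

Lemma packing_of_double_rays D K (DS : set (digraph V)) : K 0 ->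
  K #<= DS -> disjoint_double_rays D DS -> exists o, packing (arc D) (arc D) K o.
Proof.
move=> K0 /(enum_card_le empty_digraph) [F [FR Finj]] [hD tr].
have [d Hd] : exists d : nat -> int -> V, forall i, K i ->
    packing (arc D) (arc D) `I_1 (fun=> d i) /\ forall z, vset (F i) (d i z).
  apply: (choice_on (P := fun i f =>
    packing (arc D) (arc D) `I_1 (fun=> f) /\ forall z, vset (F i) (f z)) K0) => i Ki.
  have [[_ sub] /double_ray_param [f [rf vf]]] := hD _ (FR i Ki).
  by exists f; split=> //; exact: packing_mono rf.
exists d; apply: double_packing => [i z Ki|i j y z Ki Kj e].
  by have [pk _] := Hd i Ki; exact: (packing_step z pk (isT : `I_1 0)).
have ij : i = j.
  apply: Finj => //; apply: tr; [exact: FR|exact: FR|].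
  by exists (d i y); split; [exact: (Hd i Ki).2 | rewrite e; exact: (Hd j Kj).2].
subst j; split=> //; have [pk _] := Hd i Ki.
by have [] := packing_inj pk (isT : `I_1 0) (isT : `I_1 0) e.
Qed.

Lemma card_image_on K T (f : nat -> T) : (forall i j, K i -> K j -> f i = f j -> i = j) ->
  f @` K #= K.
Proof. by move=> finj; apply: inj_card_eq => i j; rewrite !in_setE; exact: finj. Qed.

Lemma rays_antirays_of_packing D K o : packing (arc D) unrelated K o ->
  exists RS AS, [/\ RS #= K, AS #= K & disjoint_rays_antirays D RS AS].
Proof.
move=> pk; have [r a d _] := pk.
pose R i := ray_digraph (fun p => o i (Posz p)).
pose A i := reverse (ray_digraph (fun p => o i (Negz p))).
have RR i j z y : K i -> K j -> o i z = o j y -> i = j by move=> Ki Kj /(packing_inj pk Ki Kj) [].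
exists (R @` K), (A @` K); split.
- apply: card_image_on => i j Ki Kj /(congr1 (@vset V)) e.
  have : vset (R j) (o i (Posz 0)) by rewrite -e; exists 0.
  by move=> [p _ /esym]; exact: RR.
- apply: card_image_on => i j Ki Kj /(congr1 (@vset V)) e.
  have : vset (A j) (o i (Negz 0)) by rewrite -e; exists 0.
  by move=> [p _ /esym]; exact: RR.
split.
- move=> _ [i Ki <-]; split; first exact/ray_digraph_sub/(rays_is_ray r Ki).
  by apply/ray_digraphP; case: (rays_is_ray r Ki).
- move=> _ [i Ki <-]; split; last by apply/ray_digraphP; case: (rays_is_ray a Ki).
  have [st _] := rays_is_ray a Ki; split=> [_ [p _ <-]|u v [p [-> ->]]]; last exact: st.
  by have [] := arc_vset (st p).
- move=> P Q [[i Ki <-]|[i Ki <-]] [[j Kj <-]|[j Kj <-]] [v [[p _ <-] [q _ e]]].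
  + by rewrite (RR _ _ _ _ Kj Ki e).
  + by case: (d _ _ _ _ Ki Kj (esym e)).
  + by case: (d _ _ _ _ Kj Ki e).
  + by rewrite (RR _ _ _ _ Kj Ki e).
Qed.

Lemma double_rays_of_packing D K o : packing (arc D) (arc D) K o ->
  exists DS, DS #= K /\ disjoint_double_rays D DS.
Proof.
move=> pk; pose T i := double_ray_digraph (o i).
have RR i j z y : K i -> K j -> o i z = o j y -> i = j by move=> Ki Kj /(packing_inj pk Ki Kj) [].
exists (T @` K); split.
  apply: card_image_on => i j Ki Kj /(congr1 (@vset V)) e.
  have : vset (T j) (o i 0%R) by rewrite -e; exists 0%R.
  by move=> [p _ /esym]; exact: RR.
split.
- move=> _ [i Ki <-]; split; last first.
    by apply: double_ray_digraphP => y z /(packing_inj pk Ki Ki) [].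
  split=> [_ [z _ <-]|u v [z [-> ->]]]; last exact: (packing_step z pk Ki).
  by have [] := arc_vset (packing_step z pk Ki).
- move=> P Q [i Ki <-] [j Kj <-] [v [[p _ <-] [q _ e]]].
  by rewrite (RR _ _ _ _ Kj Ki e).
Qed.

Lemma infinite_card_setT T (A : set T) : A #= [set: nat] -> infinite_set A.
Proof. by move=> /card_eqPle [_ le]; apply/infiniteP. Qed.

Lemma unbounded_rays_antirays D :
  (forall n, has_n_rays_antirays D n) <-> unbounded_packing (arc D) unrelated.
Proof.
split=> h n.
  (* Size [n.+1] guarantees that the index set contains 0, as the choice of representatives
     needs. *)
  have [RS [AS [/card_eqPle [_ cR] /card_eqPle [_ cA] dis]]] := h n.+1.
  have [o pk] := packing_of_rays_antirays (ltn0Sn n : `I_n.+1 0) cR cA dis.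
  by exists o; apply: packing_mono pk => // i; exact: ltnW.
by have [o /rays_antirays_of_packing] := h n.
Qed.

Lemma infinite_rays_antirays D :
  has_infinite_rays_antirays D <-> infinite_packing (arc D) unrelated.
Proof.
split=> [[RS [AS [/infiniteP cR /infiniteP cA dis]]]|[o /rays_antirays_of_packing]].
  exact: (packing_of_rays_antirays (I : [set: nat] 0) cR cA dis).
by move=> [RS [AS [cR cA dis]]]; exists RS, AS; split=> //; exact: infinite_card_setT.
Qed.

Lemma unbounded_double_rays D :
  (forall n, has_n_double_rays D n) <-> unbounded_packing (arc D) (arc D).
Proof.
split=> h n.
  have [DS /card_eqPle [_ cD] dis] := h n.+1.
  have [o pk] := packing_of_double_rays (ltn0Sn n : `I_n.+1 0) cD dis.
  by exists o; apply: packing_mono pk => // i; exact: ltnW.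
by have [o /double_rays_of_packing [DS [? ?]]] := h n; exists DS.
Qed.

Lemma infinite_double_rays D :
  has_infinite_double_rays D <-> infinite_packing (arc D) (arc D).
Proof.
split=> [[DS /infiniteP cD dis]|[o /double_rays_of_packing [DS [cD dis]]]].
  exact: (packing_of_double_rays (I : [set: nat] 0) cD dis).
by exists DS => //; exact: infinite_card_setT.
Qed.

(** Minimal walks are chosen one after the other outside the finitely many earlier vertices;
    minimality keeps their interiors off A and B. *)
Lemma infinite_set_dipaths E A B :
  (forall X, finite_set X -> linked E (~` X) A B) -> A `<=` incident E ->
  exists S, [/\ infinite_set S, pairwise_disjoint S
    & forall P, S P -> subdigraph P (relation_digraph E) /\ set_dipath A B P].
Proof.
move=> lk Ainc.
have [n0 [f0 _]] := lk set0 (finite_set0 V).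
pose W (x : nat * (nat -> V)) := [set v | exists2 p, p < x.1.+1 & v = x.2 p].
have [|w Hw] := @history_choice (nat * (nat -> V)) (fun s x =>
  [/\ walk E (~` [set v | exists2 k, k < size s & W (nth (n0, f0) s k) v]) x.1 x.2,
     A (x.2 0) /\ B (x.2 x.1), forall p q, p <= x.1 -> q <= x.1 -> x.2 p = x.2 q -> p = q,
     forall p, p <= x.1 -> A (x.2 p) -> p = 0 & forall p, p <= x.1 -> B (x.2 p) -> p = x.1]).
  move=> s; have fX : finite_set [set v | exists2 k, k < size s & W (nth (n0, f0) s k) v].
    apply: (finite_bigcup_lt (F := fun k => W (nth (n0, f0) s k))) => k _.
    set x := nth (n0, f0) s k.
    by apply: sub_finite_set (finite_image x.2 (finite_II x.1.+1)) => v [p pn ->]; exists p.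
  by have [n [f h]] := minimal_walk (lk _ fX); exists (n, f).
pose P k := walk_digraph (w k).1 (w k).2.
have PW k v : vset (P k) v -> W (w k) v by move=> [p pn <-]; exists p.
have lt_dis k l v : k < l -> vset (P k) v -> ~ vset (P l) v.
  move=> kl /PW Wv [p pn vE]; have [[_ nX] _ _ _ _] := Hw l.
  apply: (nX p pn); rewrite size_mkseq; exists k => //.
  by rewrite nth_mkseq // vE.
have P0 k : vset (P k) ((w k).2 0) by exists 0.
have PP k l v : vset (P k) v -> vset (P l) v -> k = l.
  by case: (ltngtP k l) => // [/lt_dis h /h|/lt_dis h + /h].
exists (range P); split.
- apply: (infinite_of_inj (f := P)) => [k l e|k]; last by exists k.
  by apply: (PP k l _ (P0 k)); rewrite -e.
- by move=> _ _ [k _ <-] [l _ <-] [v [vk vl]]; rewrite (PP _ _ _ vk vl).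
move=> _ [k _ <-]; have [[st _] [A0 Bn] inj hA hB] := Hw k; split.
  by apply: walk_subdigraph => //; exact: Ainc.
exists ((w k).2 0), ((w k).2 (w k).1); split=> //; first exact: walk_dipath.
by move=> _ [p pn <-] n0' nn [/(hA p pn) e|/(hB p pn) e]; [apply: n0'|apply: nn]; rewrite e.
Qed.

(** Every ray or anti-ray has infinitely many vertices, so rich linkage makes any two of them
    equivalent; the packing provides at least one. *)
Lemma richly_linked_one_ended E : infinite_packing E unrelated -> richly_linked E E ->
  one_ended (relation_digraph E).
Proof.
move=> [o pk] rich; set D := relation_digraph E.
have inf Q : ray_or_antiray_in D Q -> infinite_set (vset Q) /\ vset Q `<=` incident E.
  move=> [[sub _] rQ]; split=> //.
  by case: rQ => [/ray_param|/antiray_param] [f [[_ finj] fQ]]; exact: infinite_of_inj fQ.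
have le Q R : ray_or_antiray_in D Q -> ray_or_antiray_in D R -> ray_le D Q R.
  move=> /inf [iQ Qi] /inf [iR Ri]; apply: infinite_set_dipaths => // X fX.
  exact: rich.
have cls R : ray_or_antiray_in D R ->
    [set Q | ray_or_antiray_in D Q /\ ray_equiv D Q R] = [set Q | ray_or_antiray_in D Q].
  move=> hR; apply/seteqP; split=> Q /=; first by case.
  by move=> hQ; split=> //; split; exact: le.
exists [set Q | ray_or_antiray_in D Q]; split; last by move=> e [R hR ->]; rewrite cls.
have [r _ _ _] := pk; have rr := rays_is_ray r (I : [set: nat] 0).
have hR : ray_or_antiray_in D (ray_digraph (fun p => o 0 (Posz p))).
  by split; [exact: ray_digraph_sub | left; apply: ray_digraphP; case: rr].
by exists (ray_digraph (fun p => o 0 (Posz p))); rewrite ?cls.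
Qed.
End Digraphs.

(** * Comparison of the two kinds of counterexample *)

Theorem theorem5p1 :
  (forall (V : Type) (D : digraph V), RA_counterexample D -> DR_counterexample D) /\
  ((forall (V : Type) (D : digraph V),
      one_ended D -> has_infinite_rays_antirays D -> has_infinite_double_rays D) ->
   ((exists (V : Type) (D : digraph V), RA_counterexample D) <->
    (exists (V : Type) (D : digraph V), DR_counterexample D))).
Proof.
have RA_DR V (D : digraph V) : RA_counterexample D -> DR_counterexample D.
  move=> [/unbounded_rays_antirays ub ninf]; split.
    apply/unbounded_double_rays/unbounded_rays_antirays_double_rays => //.
    by move=> /infinite_rays_antirays.
  move=> /infinite_double_rays inf; apply: ninf; apply/infinite_rays_antirays.
  exact: infinite_mono inf.
split=> // one_ended_double; split=> [[V [D /RA_DR ?]]|[V [D [/unbounded_double_rays ub ninf]]]].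
  by exists V, D.
have {}ninf : ~ infinite_packing (arc D) (arc D) by move=> /infinite_double_rays.
(* If no RA-counterexample existed, infinitely many disjoint double rays could be found in D. *)
apply: contrapT => noRA; apply: (ninf).
have [S [ubS undiv]] := exists_undivided ub ninf.
have ninfS : ~ infinite_packing (restrict (arc D) S) (restrict (arc D) S).
  by apply: contra_not ninf; apply: infinite_mono => u v [].
have [F [FE ubF rich]] := richly_linked_subrelation ubS ninfS undiv.
(* F has arbitrarily large packings and is no RA-counterexample, so it has an infinite one. *)
have [q pk] : infinite_packing F unrelated.
  apply/(infinite_rays_antirays (relation_digraph F)); apply: contrapT => ninfF.
  apply: noRA; exists V, (relation_digraph F); split=> //.
  exact/unbounded_rays_antirays.
have [G [GE infG richG]] := richly_linked_packing FE rich pk.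
have /infinite_double_rays infGG : has_infinite_double_rays (relation_digraph G).
  apply: one_ended_double; first exact: richly_linked_one_ended.
  exact/infinite_rays_antirays.
by apply: infinite_mono infGG => u v /GE [].
Qed.
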